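(* Let $H\ne0$ be a real separable Hilbert space, $E\ne0$ a complex separable Hilbert space, $k\ge2$, $\sigma\ge1$ and $\rho_1,\dots,\rho_k>0$. Ordered multiplication $(K_1,\dots,K_k)\mapsto K_1\star\cdots\star K_k$ on the finite core is bounded from $\prod_{i=1}^k\mathcal C_{\rho_i,2}$ into $\mathcal C_{\sigma,2}$ if and only if $$\sum_{i=1}^k\frac1{1+\rho_i^2}\le\frac1{1+\sigma^2}.$$ When this inequality holds, the best multilinear constant is one: $$\mathcal N_{\sigma,2}(K_1\star\cdots\star K_k)\le\prod_{i=1}^k\mathcal N_{\rho_i,2}(K_i).$$ For equal input radii $\rho_1=\dots=\rho_k=\rho$, the exact condition is $\rho^2\ge k(1+\sigma^2)-1$.
   Context: Let $H_{\mathbb C}$ be the complexification of $H$ and $\mathcal K_m=H_{\mathbb C}^{\odot m}\otimes_2\mathcal S_2(E)$ (symmetric $m$-fold Hilbert tensor power of $H_{\mathbb C}$, tensored with the Hilbert--Schmidt operators on $E$; $\mathcal K_0=\mathcal S_2(E)$). For $K=(K_m)_{m\ge0}$ with $K_m\in\mathcal K_m$ put $\mathcal N_{\rho,2}(K)=\sum_{m\ge0}\rho^m\sqrt{m!}\,\|K_m\|_{\mathcal K_m}$, and let $\mathcal C_{\rho,2}$ be the space of such $K$ with $\mathcal N_{\rho,2}(K)<\infty$. The finite core consists of sequences with finitely many nonzero terms, each a finite combination of symmetrized elementary basis tensors with operator coefficients having finitely many nonzero matrix entries. On the finite core the (associative) product is $$(K\star L)_j=\sum_{m+n-2r=j}r!\binom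 mr\binom nr\Gamma_r(K_m,L_n),\qquad \Gamma_r(f\otimes A,g\otimes B)=(f\widetilde\otimes_rg)\otimes AB,$$ where $f\widetilde\otimes_r g$ contracts $r$ source indices of $f$ and $g$ using the complex-bilinear extension of the real inner product of $H$ and symmetrizes the remaining source indices. (It corresponds to ordinary multiplication of the operator-valued Gaussian polynomials $\sum_mI_m(K_m)$, $I_m$ the multiple Wiener integral over an isonormal process on $H$.) Boundedness means $\mathcal N_{\sigma,2}(K_1\star\cdots\star K_k)\le C\prod_i\mathcal N_{\rho_i,2}(K_i)$ for all finite-core inputs and some $C<\infty$; the product then extends uniquely by continuity. *)

(* Defs.v *)
(* MathComp-Analysis, over an arbitrary [R : realType]; complex scalars are
   [R[i]].

   Model of the chaos kernels.  An element of H_C^{(.) m} (x)_2 S_2(E) is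
   viewed as the m-linear map H^m -> S_2(E) that it induces: f (x) A is the map
   x |-> <f, x_1 (x) ... (x) x_m> A, where < , > is the complex-bilinear
   extension of the real inner product.  Since real-multilinear maps on H with
   complex values are the same as complex-multilinear maps on H_C, the
   complexification does not have to be formed.  A whole sequence (K_m)_m is a
   single function [K : seq H -> E -> E], because [seq H] is the disjoint union
   of the H^m : the kernel K_m is K restricted to the lists of length m. *)
From mathcomp Require Import all_boot all_order all_algebra.
From mathcomp Require Import perm complex.
From mathcomp Require Import all_classical all_reals all_analysis.

Set Implicit Arguments.
Unset Strict Implicit.
Unset Printing Implicit Defensive.

Import Order.TTheory GRing.Theory Num.Theory.
Import numFieldNormedType.Exports.

Local Open Scope classical_set_scope.
Local Open Scope ring_scope.

Definition separable_space (T : topologicalType) : Prop :=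
  exists D : set T, countable D /\ dense D.

Definition induces_norm (F : numFieldType) (V : normedModType F)
    (dot : V -> V -> F) : Prop :=
  forall x, dot x x = `|x| ^+ 2.

(* Hilbert basis: a maximal orthonormal family. *)
Definition orthonormal_basis (F : numFieldType) (V : normedModType F)
    (dot : V -> V -> F) (B : choiceType) (b : B -> V) : Prop :=
  (forall i j, dot (b i) (b j) = (i == j)%:R) /\
  (forall x, (forall i, dot x (b i) = 0) -> x = 0).

Section GaussianChaos.
Context (R : realType) (H : completeNormedModType R)
  (dotH : {dot H for idfun}).
(* [dotE] is linear in its first argument, conjugate-linear in its second. *)
Context (E : completeNormedModType R[i]) (dotE : {dot E for Num.conj}).
Context (I J : choiceType) (e : I -> H) (eps : J -> E).

Definition chaos := seq H -> E -> E.

Definition permute (x : seq H) (s : 'S_(size x)) : seq H :=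
  [seq tnth (in_tuple x) (s l) | l <- enum 'I_(size x)].

Definition symmetrize (K : chaos) : chaos := fun x v =>
  ((size x)`!%:R)^-1 *: \sum_(s : 'S_(size x)) K (permute s) v.

Definition elementary (h : seq H) (A : E -> E) : chaos := fun x v =>
  if size x == size h
  then (\prod_(p <- zip h x) dotH p.1 p.2)%:C%C *: A v else 0.

Definition finite_matrix (A : E -> E) : Prop :=
  exists s : seq (R[i] * (J * J)), forall v,
    A v = \sum_(t <- s) (t.1 * dotE v (eps t.2.2)) *: eps t.2.1.

Definition finite_core (K : chaos) : Prop :=
  (exists N : nat, forall x v, (N <= size x)%N -> K x v = 0) /\
  (forall m : nat,
    exists (n : nat) (i : 'I_n -> m.-tuple I) (A : 'I_n -> E -> E),
      (forall l, finite_matrix (A l)) /\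
      (forall x v, size x = m ->
        K x v = \sum_(l < n) symmetrize (elementary (map e (i l)) (A l)) x v)).

(* Gamma_r(K_m, L_n), evaluated at [x] of length m + n - 2r.  The real inner
   product being extended bilinearly, contracting r source indices is summing
   over e_{j_1} (x) ... (x) e_{j_r} plugged into both factors.  On the finite
   core only finitely many [j] contribute. *)
Definition sym_contraction (r m : nat) (K L : chaos) : chaos :=
  symmetrize (fun x v =>
    \sum_(j \in [set: r.-tuple I])
      K (take (m - r) x ++ map e j) (L (drop (m - r) x ++ map e j) v)).

(* The index [t] is (m, n, r); on the finite core only finitely many indices
   contribute. *)
Definition star (K L : chaos) : chaos := fun x v =>
  \sum_(t \in [set t : nat * nat * nat |
      [/\ t.2 <= t.1.1, t.2 <= t.1.2 & t.1.1 + t.1.2 - t.2.*2 = size x]%N])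
    (t.2`! * 'C(t.1.1, t.2) * 'C(t.1.2, t.2))%:R
      *: sym_contraction t.2 t.1.1 K L x v.

Definition star_seq (Ks : seq chaos) : chaos :=
  if Ks is K :: Ks' then foldl star K Ks' else fun _ _ => 0.

Definition HS_norm2 (A : E -> E) : \bar R :=
  \esum_(a in [set: J]) (complex.Re (dotE (A (eps a)) (A (eps a))))%:E.

Definition kernel_norm (m : nat) (K : chaos) : \bar R :=
  sqrte (\esum_(i in [set: m.-tuple I]) HS_norm2 (K (map e i))).

Definition chaos_norm (rho : R) (K : chaos) : \bar R :=
  (\sum_(0 <= m <oo) (rho ^+ m * Num.sqrt (m`!%:R))%:E * kernel_norm m K)%E.

Definition star_bounded_by (k : nat) (sigma : R) (rho : 'I_k -> R) (C : R) :
    Prop :=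
  forall K : 'I_k -> chaos, (forall i, finite_core (K i)) ->
    (chaos_norm sigma (star_seq [seq K i | i <- enum 'I_k])
       <= C%:E * \prod_(i < k) chaos_norm (rho i) (K i))%E.

Definition star_bounded (k : nat) (sigma : R) (rho : 'I_k -> R) : Prop :=
  exists C : R, star_bounded_by sigma rho C.

End GaussianChaos.

(* Main.v *)
Require Import Defs.
From mathcomp Require Import all_boot all_order all_algebra.
From mathcomp Require Import perm complex.
From mathcomp Require Import all_classical all_reals all_analysis.
From mathcomp Require Import ring lra zify.
Set Implicit Arguments.
Unset Strict Implicit.
Unset Printing Implicit Defensive.
Import Order.TTheory GRing.Theory Num.Theory.
Import numFieldNormedType.Exports.
Local Open Scope classical_set_scope.
Local Open Scope ring_scope.

(** Evaluated on words in the orthonormal basis [e], an element of the finite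
    core is a finitely supported family of operators on the span of finitely
    many [eps j], and the product is a finite sum over triples [(m, n, r)] of
    averages over permutations of contracted products.

    Sufficiency of the condition.  The Hilbert-Schmidt norm is
    submultiplicative, the Cauchy-Schwarz inequality in the contracted letters
    bounds the l2 norm of a contraction by the product of the l2 norms
    ([word_norm_contraction]), and permuting letters preserves l2 norms
    ([word_norm_star]).  As the chaos norm is a weighted l1 sum over the
    degrees, the bound for two factors, with constant one, follows from an
    inequality between numbers for each pair [(m, n)] ([two_factor_scalar]).
    Divided by [sqrt (m! n!)], its [r]-th term involves the square root of the
    product of three binomial coefficients.  Each of them is a binomial
    probability divided by powers of the probabilities of success and failure,
    and when [1 / (1 + rho1^2) + 1 / (1 + rho2^2) = 1 / (1 + tau^2)] the three
    success probabilities can be chosen so that these powers cancel against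
    those of the radii.  After bounding one binomial probability by one, what is
    left is a sum over [r] of square roots of products of two of them, at most
    one by the inequality of the means.  Since [1 / (1 + rho^2)] is additive in
    this bound, the factors of a longer product are absorbed one after the other
    ([chaos_norm_foldl]).

    Necessity.  The exponential vectors [E_t = sum_m t^m / m! e^m] of a unit
    vector satisfy [E_s * E_t = exp (s t) E_(s + t)], and the square of the norm
    [sum_m (rho t)^m / sqrt (m!)] of [E_t] is [exp (rho^2 t^2)] up to a
    constant and an arbitrarily small loss in the exponent.  Boundedness on
    products of exponential vectors, truncated so as to lie in the finite core
    ([star_seq_exp_chaos]), hence forces
    [(1 + sigma^2) (sum_i t_i)^2 <= sum_i (1 + rho_i^2) t_i^2] for all
    nonnegative [t_i] ([radii_of_growth]); for [t_i = 1 / (1 + rho_i^2)] this is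
    the condition on the radii.  All [t_i = 0] shows that no constant below one
    is possible. *)

(** * Binomial weights and the two-factor scalar inequality *)

Section ScalarInequality.
Context (R : realType).

Definition binomial_weight (t : R) (m r : nat) : R :=
  'C(m, r)%:R * t ^+ r * (1 - t) ^+ (m - r).

Lemma binomial_weight_ge0 t m r : 0 <= t <= 1 -> 0 <= binomial_weight t m r.
Proof.
by move=> /andP[t0 t1]; rewrite !mulr_ge0 ?exprn_ge0 ?subr_ge0.
Qed.

Lemma sum_binomial_weight t m :
  \sum_(r < m.+1) binomial_weight t m r = 1.
Proof.
have <- : ((1 - t) + t) ^+ m = 1 by rewrite subrK expr1n.
rewrite exprDn; apply: eq_bigr => r _.
by rewrite /binomial_weight -mulrA mulr_natl [X in X *+ _]mulrC.
Qed.

Lemma sum_binomial_weight_le1 t m n : 0 <= t <= 1 ->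
  \sum_(r < n) binomial_weight t m r <= 1.
Proof.
move=> t01; have w0 r := binomial_weight_ge0 m r t01.
rewrite -(sum_binomial_weight t m) -!(big_mkord xpredT (binomial_weight t m)).
have [le_nm|lt_mn] := leqP n m.+1.
  by rewrite [leRHS](big_cat_nat (n := n)) //= lerDl sumr_ge0.
rewrite (big_cat_nat (n := m.+1)) ?(ltnW lt_mn) //=.
rewrite [X in _ + X]big1_seq ?addr0 // => r /andP[_]; rewrite mem_index_iota.
by move=> /andP[ltmr _]; rewrite /binomial_weight bin_small // !mul0r.
Qed.

Lemma binomial_weight_le1 t m r : 0 <= t <= 1 -> binomial_weight t m r <= 1.
Proof.
move=> t01; apply: le_trans (sum_binomial_weight_le1 m r.+1 t01).
by rewrite big_ord_recr /= lerDr sumr_ge0 // => i _; apply: binomial_weight_ge0.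
Qed.

Lemma sqrt_mul_le_mean (x y : R) : 0 <= x -> 0 <= y ->
  Num.sqrt (x * y) <= (x + y) / 2.
Proof.
move=> x0 y0; rewrite sqrtrM // -{2}(sqr_sqrtr x0) -{2}(sqr_sqrtr y0).
rewrite ler_pdivlMr //; have := sqr_ge0 (Num.sqrt x - Num.sqrt y); nra.
Qed.

(** With [m = p + r] and [n = q + r], the weight of a contraction relative to
    [sqrt (m! n! / (p + q)!)] is the square root of the product of three
    binomial coefficients; squaring avoids the roots. *)
Lemma contraction_weight (m n r : nat) : (r <= m)%N -> (r <= n)%N ->
  ((r`! * 'C(m, r) * 'C(n, r)) ^ 2 * (m + n - r.*2)`! =
   'C(m, r) * 'C(n, r) * 'C(m + n - r.*2, m - r) * (m`! * n`!))%N.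
Proof.
move=> rm rn; have [p ->] : exists p, m = (p + r)%N by exists (m - r)%N; lia.
have [q ->] : exists q, n = (q + r)%N by exists (n - r)%N; lia.
have -> : (p + r + (q + r) - r.*2 = p + q)%N by lia.
have -> : (p + r - r = p)%N by lia.
have h1 := bin_fact (leq_addl p r); rewrite addnK in h1.
have h2 := bin_fact (leq_addl q r); rewrite addnK in h2.
have h3 := bin_fact (leq_addr q p); rewrite addKn in h3.
move: h1 h2 h3; set x := 'C(_, _); set y := 'C(_, _); set z := 'C(_, _).
by move=> <- <- <-; ring.
Qed.

(** The three binomial coefficients of [contraction_weight] are compared with
    binomial weights of parameters [t], [s] and [u]. The first two weights are
    kept and summed over [r]; the third is bounded by one. *)
Lemma two_factor_scalar (rho1 rho2 tau : R) (m n N : nat) :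
  0 < rho1 -> 0 < rho2 -> 0 < tau ->
  (1 + rho1 ^+ 2)^-1 + (1 + rho2 ^+ 2)^-1 = (1 + tau ^+ 2)^-1 ->
  \sum_(r < N | (r <= m)%N && (r <= n)%N)
     (r`! * 'C(m, r) * 'C(n, r))%:R * (tau ^+ (m + n - r.*2) *
       Num.sqrt ((m + n - r.*2)`!%:R)) <=
  (rho1 ^+ m * Num.sqrt (m`!%:R)) * (rho2 ^+ n * Num.sqrt (n`!%:R)).
Proof.
move=> rho1_gt0 rho2_gt0 tau_gt0 Hc.
set a := (1 + rho1 ^+ 2)^-1 in Hc; set b := (1 + rho2 ^+ 2)^-1 in Hc.
set c := (1 + tau ^+ 2)^-1 in Hc.
have gt0 (x : R) : 0 < x -> 0 < (1 + x ^+ 2)^-1 < 1.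
  move=> x0; have x1 : 1 < 1 + x ^+ 2 by rewrite ltrDl exprn_gt0.
  by rewrite invr_gt0 invf_lt1 ?(lt_trans ltr01 x1) // x1.
have sqE (x : R) : 0 < x -> x ^+ 2 = (1 - (1 + x ^+ 2)^-1) / (1 + x ^+ 2)^-1.
  move=> x0; have : 1 + x ^+ 2 != 0 by rewrite gt_eqF // addr_gt0 ?exprn_gt0.
  by move=> ?; field.
have /andP[a0 a1] : 0 < a < 1 := gt0 _ rho1_gt0.
have /andP[b0 b1] : 0 < b < 1 := gt0 _ rho2_gt0.
have /andP[c0 c1] : 0 < c < 1 := gt0 _ tau_gt0.
have aE : rho1 ^+ 2 = (1 - a) / a := sqE _ rho1_gt0.
have bE : rho2 ^+ 2 = (1 - b) / b := sqE _ rho2_gt0.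
have cE : tau ^+ 2 = (1 - c) / c := sqE _ tau_gt0.
(* These parameters solve [rho1^2 (1 - t) u = tau^2],
   [rho2^2 (1 - s) (1 - u) = tau^2] and [rho1^2 rho2^2 t s = 1], so that the
   powers of the radii absorb the bases of the three weights. *)
pose t := b / (1 - a); pose s := a / (1 - b); pose u := a / c.
have t01 : 0 <= t <= 1.
  by rewrite divr_ge0 ?subr_ge0 ?(ltW b0) ?(ltW a1) //= ler_pdivrMr; lra.
have s01 : 0 <= s <= 1.
  by rewrite divr_ge0 ?subr_ge0 ?(ltW a0) ?(ltW b1) //= ler_pdivrMr; lra.
have u01 : 0 <= u <= 1.
  by rewrite divr_ge0 ?(ltW a0) ?(ltW c0) //= ler_pdivrMr; lra.
have -> : (rho1 ^+ m * Num.sqrt (m`!%:R)) * (rho2 ^+ n * Num.sqrt (n`!%:R)) =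
    rho1 ^+ m * rho2 ^+ n * Num.sqrt ((m`! * n`!)%:R).
  by rewrite natrM sqrtrM //; ring.
set B := rho1 ^+ m * _ * _.
have B0 : 0 <= B by rewrite !mulr_ge0 ?exprn_ge0 ?sqrtr_ge0 // ltW.
pose w r := Num.sqrt (binomial_weight t m r * binomial_weight s n r).
have term r : (r <= m)%N && (r <= n)%N ->
   (r`! * 'C(m, r) * 'C(n, r))%:R * (tau ^+ (m + n - r.*2) *
       Num.sqrt ((m + n - r.*2)`!%:R)) <= B * w r.
  move=> /andP[rm rn].
  rewrite -ler_sqr ?nnegrE; last 2 first.
  - by rewrite !mulr_ge0 ?exprn_ge0 ?sqrtr_ge0 // ltW.
  - by rewrite !mulr_ge0 ?exprn_ge0 ?sqrtr_ge0 // ltW.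
  have ww : 0 <= binomial_weight t m r * binomial_weight s n r.
    by apply: mulr_ge0; apply: binomial_weight_ge0.
  rewrite !exprMn !sqr_sqrtr //.
  have -> : (r`! * 'C(m, r) * 'C(n, r))%:R ^+ 2 * ((tau ^+ (m + n - r.*2)) ^+ 2 *
      (m + n - r.*2)`!%:R) = ((r`! * 'C(m, r) * 'C(n, r)) ^ 2 *
      (m + n - r.*2)`!)%N%:R * (tau ^+ 2) ^+ (m + n - r.*2) :> R.
    by rewrite [in RHS]natrM natrX exprAC; ring.
  rewrite contraction_weight //.
  have [p mE] : exists p, m = (p + r)%N by exists (m - r)%N; rewrite subnK.
  have [q nE] : exists q, n = (q + r)%N by exists (n - r)%N; rewrite subnK.
  rewrite mE nE -addnn addnACA !addnK.
  have := binomial_weight_le1 (p + q) p u01.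
  rewrite /binomial_weight !addnK addKn => hu.
  have c0' : c != 0 by rewrite gt_eqF.
  have cab : c = a + b by [].
  have a' : a != 0 by rewrite gt_eqF.
  have b' : b != 0 by rewrite gt_eqF.
  have a1' : 1 - a != 0 by rewrite gt_eqF // subr_gt0.
  have b1' : 1 - b != 0 by rewrite gt_eqF // subr_gt0.
  have ab' : a + b != 0 by rewrite -cab.
  have e1 : rho1 ^+ 2 * (1 - t) * u = tau ^+ 2.
    by rewrite aE cE /t /u cab; field; rewrite ab' a1' a'.
  have e2 : rho2 ^+ 2 * (1 - s) * (1 - u) = tau ^+ 2.
    by rewrite bE cE /s /u cab; field; rewrite ab' b1' b'.
  have e3 : rho1 ^+ 2 * rho2 ^+ 2 * t * s = 1.
    by rewrite aE bE /s /t; field; rewrite a' b' b1' a1'.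
  clearbody t s u.
  have h1 : 0 <= 1 - t by lra.
  have h2 : 0 <= 1 - s by lra.
  set U := (rho1 ^+ 2 * (1 - t)) ^+ p * (rho2 ^+ 2 * (1 - s)) ^+ q.
  have U0 : 0 <= U by rewrite !mulr_ge0 // exprn_ge0 // mulr_ge0 // sqr_ge0.
  have -> : (tau ^+ 2) ^+ (p + q) = U * (u ^+ p * (1 - u) ^+ q).
    by rewrite exprD -{1}e1 -e2 /U exprMn [X in _ * X = _]exprMn mulrACA.
  have -> : (rho1 ^+ (p + r)) ^+ 2 * (rho2 ^+ (q + r)) ^+ 2 * ((p + r)`! * (q + r)`!)%:R *
      ('C(p + r, r)%:R * t ^+ r * (1 - t) ^+ p *
       ('C(q + r, r)%:R * s ^+ r * (1 - s) ^+ q)) =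
      ('C(p + r, r) * 'C(q + r, r) * ((p + r)`! * (q + r)`!))%:R * U.
    have <- : U * (rho1 ^+ 2 * rho2 ^+ 2 * t * s) ^+ r = U.
      by rewrite e3 expr1n mulr1.
    rewrite [rho1 ^+ _ ^+ 2]exprAC [rho2 ^+ _ ^+ 2]exprAC /U.
    move: (rho1 ^+ 2) (rho2 ^+ 2) (1 - t) (1 - s) => r1 r2 t' s'.
    rewrite [in RHS]natrM !exprMn !exprD !natrM.
    move: ('C(_, _)%:R) ('C(_, _)%:R) (_`!%:R) (_`!%:R) => x y f g.
    move: (t ^+ r) (s ^+ r) (t' ^+ p) (s' ^+ q) (r1 ^+ p) (r1 ^+ r) => t1 s1 t2 s2 r3 r4.
    by move: (r2 ^+ q) (r2 ^+ r) => r5 r6; ring.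
  move: hu; rewrite !natrM -mulrA.
  have x0 : 0 <= 'C(p + r, r)%:R * 'C(q + r, r)%:R *
      ((p + r)`!%:R * (q + r)`!%:R) :> R by [].
  move: x0.
  move: ('C(p + r, r)%:R) ('C(q + r, r)%:R) ('C(p + q, p)%:R)
    ((p + r)`!%:R) ((q + r)`!%:R) (u ^+ p * _) => x y z f g G x0 hu.
  have -> : x * y * z * (f * g) * (U * G) = (x * y * (f * g) * U) * (z * G) by ring.
  by rewrite -[leRHS]mulr1 ler_wpM2l // mulr_ge0.
apply: (@le_trans _ _ (\sum_(r < N | (r <= m)%N && (r <= n)%N) B * w r)).
  by apply: ler_sum => r; apply: term.
rewrite -mulr_sumr -[leRHS]mulr1 ler_wpM2l //.
apply: (@le_trans _ _ (\sum_(r < N)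
   (binomial_weight t m r + binomial_weight s n r) / 2)).
  rewrite big_mkcond; apply: ler_sum => r _.
  have wt := binomial_weight_ge0 m r t01; have ws := binomial_weight_ge0 n r s01.
  case: ifP => _; first exact: sqrt_mul_le_mean.
  by rewrite divr_ge0 ?addr_ge0.
rewrite -mulr_suml big_split /=.
have := sum_binomial_weight_le1 m N t01; have := sum_binomial_weight_le1 n N s01.
lra.
Qed.

End ScalarInequality.

(** * Finite l2 norms, and sums over words *)

Section FiniteL2.
Context (R : realType).

Definition l2norm (X : Type) (s : seq X) (f : X -> R) : R :=
  Num.sqrt (\sum_(x <- s) f x ^+ 2).

Context (X : Type) (s : seq X).
Implicit Types f g : X -> R.

Lemma l2norm_ge0 f : 0 <= l2norm s f.
Proof. exact: sqrtr_ge0. Qed.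

Lemma sum_sqr_ge0 f : 0 <= \sum_(x <- s) f x ^+ 2.
Proof. by rewrite sumr_ge0 // => x _; rewrite sqr_ge0. Qed.

Lemma l2norm_sqr f : l2norm s f ^+ 2 = \sum_(x <- s) f x ^+ 2.
Proof. by rewrite sqr_sqrtr // sum_sqr_ge0. Qed.

Lemma l2norm_le f g : (forall x, 0 <= f x <= g x) -> l2norm s f <= l2norm s g.
Proof.
move=> fg; rewrite ler_wsqrtr // ler_sum // => x _.
by have /andP[f0 fg'] := fg x; rewrite lerXn2r // nnegrE (le_trans f0).
Qed.

Lemma l2normZ c f : 0 <= c -> l2norm s (fun x => c * f x) = c * l2norm s f.
Proof.
move=> c0; rewrite /l2norm.
under eq_bigr do rewrite exprMn.
by rewrite -mulr_sumr sqrtrM ?sqr_ge0 // sqrtr_sqr ger0_norm.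
Qed.

(** Lagrange's identity: the defect in the Cauchy-Schwarz inequality is half of
    the sum of the squares [(f x * g y - f y * g x) ^+ 2]. *)
Lemma sum_mul_le_l2norm f g :
  \sum_(x <- s) f x * g x <= l2norm s f * l2norm s g.
Proof.
have [neg|pos] := leP (\sum_(x <- s) f x * g x) 0.
  by rewrite (le_trans neg) // mulr_ge0 // l2norm_ge0.
rewrite -ler_sqr ?nnegrE ?mulr_ge0 ?l2norm_ge0 ?(ltW pos) // exprMn !l2norm_sqr.
have : 0 <= \sum_(x <- s) \sum_(y <- s) (f x * g y - f y * g x) ^+ 2.
  by apply: sumr_ge0 => x _; apply: sumr_ge0 => y _; rewrite sqr_ge0.
have -> : \sum_(x <- s) \sum_(y <- s) (f x * g y - f y * g x) ^+ 2 =
    ((\sum_(x <- s) f x ^+ 2) * (\sum_(x <- s) g x ^+ 2)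
     - (\sum_(x <- s) f x * g x) ^+ 2) *+ 2.
  rewrite mulrnBl expr2 !big_distrlr /= !mulr2n.
  rewrite [X in X + _ - _]exchange_big /= -!big_split -sumrB /=.
  apply: eq_bigr => x _; rewrite -!big_split -sumrB /=.
  by apply: eq_bigr => y _; ring.
by rewrite pmulrn_lge0 // subr_ge0.
Qed.

Lemma l2normD f g : l2norm s (fun x => f x + g x) <= l2norm s f + l2norm s g.
Proof.
rewrite -ler_sqr ?nnegrE ?addr_ge0 ?l2norm_ge0 // sqrrD !l2norm_sqr.
under eq_bigr do rewrite sqrrD.
rewrite 2!big_split /= lerD2r lerD2l sumrMnl ler_pMn2r //.
exact: sum_mul_le_l2norm.
Qed.

Lemma l2norm_sum (Y : Type) (r : seq Y) (P : pred Y) (F : Y -> X -> R) :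
  l2norm s (fun x => \sum_(y <- r | P y) F y x) <=
  \sum_(y <- r | P y) l2norm s (F y).
Proof.
elim: r => [|y r IHr].
  rewrite big_nil /l2norm big1 ?sqrtr0 // => x _; by rewrite big_nil expr0n.
rewrite big_cons; case: ifP => Py; last first.
  apply: le_trans IHr; rewrite le_eqVlt; apply/orP; left; apply/eqP.
  by congr Num.sqrt; apply: eq_bigr => x _; rewrite big_cons Py.
apply: le_trans (lerD (lexx _) IHr).
apply: le_trans (l2normD _ _); rewrite le_eqVlt; apply/orP; left; apply/eqP.
by congr Num.sqrt; apply: eq_bigr => x _; rewrite big_cons Py.
Qed.

End FiniteL2.

Section Words.
Context (T : finType).

Lemma sum_tuple_cat (V : nmodType) (p q : nat) (f : seq T -> V) :
  \sum_(x : (p + q).-tuple T) f x =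
  \sum_(y : p.-tuple T) \sum_(z : q.-tuple T) f (y ++ z).
Proof.
rewrite pair_big /=.
rewrite (reindex (fun yz : p.-tuple T * q.-tuple T => cat_tuple yz.1 yz.2)) //.
have pK (x : (p + q).-tuple T) : size (take p x) == p.
  by rewrite size_takel // size_tuple leq_addr.
have qK (x : (p + q).-tuple T) : size (drop p x) == q.
  by rewrite size_drop size_tuple addKn.
exists (fun x => (Tuple (pK x), Tuple (qK x))) => [[y z] _|x _].
  congr (_, _); apply: val_inj => /=.
    by rewrite take_size_cat ?size_tuple.
  by rewrite drop_size_cat ?size_tuple.
by apply: val_inj => /=; rewrite cat_take_drop.
Qed.

(** The length [d] is kept apart from [size x] so that all words of one length
    are rearranged by permutations of the same type. *)
Definition permuted (U : Type) (x0 : U) (d : nat) (s : 'S_d) (x : seq U) : seq U :=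
  [seq nth x0 x (s l) | l <- enum 'I_d].

Lemma size_permuted (U : Type) (x0 : U) d (s : 'S_d) x : size (permuted x0 s x) = d.
Proof. by rewrite size_map size_enum_ord. Qed.

Lemma permuted_tuple (U : Type) (x0 : U) d (s : 'S_d) (x : d.-tuple U) :
  permuted x0 s x = [tuple tnth x (s l) | l < d] :> seq U.
Proof.
by rewrite /permuted /=; apply: eq_map => l; rewrite (tnth_nth x0).
Qed.

Lemma sum_permuted (V : nmodType) (x0 : T) d (s : 'S_d) (f : seq T -> V) :
  \sum_(x : d.-tuple T) f (permuted x0 s x) = \sum_(x : d.-tuple T) f x.
Proof.
rewrite [RHS](reindex (fun x : d.-tuple T => [tuple tnth x (s l) | l < d])) /=.
  by apply: eq_bigr => x _; rewrite permuted_tuple.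
exists (fun x : d.-tuple T => [tuple tnth x ((s^-1)%g l) | l < d]) => x _.
  by apply: eq_from_tnth => l; rewrite !tnth_mktuple permKV.
by apply: eq_from_tnth => l; rewrite !tnth_mktuple permK.
Qed.

End Words.

Section Contraction.
Context (R : realType) (T : finType).
Implicit Types (k l : seq T -> R) (p q r : nat).

Definition word_norm (d : nat) (f : seq T -> R) : R :=
  l2norm (index_enum (d.-tuple T)) (fun w => f w).

Definition contraction p r k l (u : seq T) : R :=
  \sum_(j : r.-tuple T) k (take p u ++ j) * l (drop p u ++ j).

(** Cauchy-Schwarz in the contracted letters bounds the contraction at
    [y ++ z] by the product of a function of [y] and a function of [z], and the
    sum over the words factors. *)
Lemma word_norm_contraction p q r k l :
  (forall w, 0 <= k w) -> (forall w, 0 <= l w) ->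
  word_norm (p + q) (contraction p r k l) <= word_norm (p + r) k * word_norm (q + r) l.
Proof.
move=> k0 l0; rewrite -ler_sqr ?nnegrE ?mulr_ge0 ?l2norm_ge0 // exprMn !l2norm_sqr /=.
rewrite (sum_tuple_cat p q (fun w => contraction p r k l w ^+ 2)).
rewrite (sum_tuple_cat p r (fun w => k w ^+ 2)) (sum_tuple_cat q r (fun w => l w ^+ 2)).
rewrite mulr_suml; apply: ler_sum => y _; rewrite mulr_sumr; apply: ler_sum => z _.
rewrite /contraction take_size_cat ?drop_size_cat ?size_tuple //.
rewrite -(l2norm_sqr _ (fun j : r.-tuple T => k (y ++ j))).
rewrite -(l2norm_sqr _ (fun j : r.-tuple T => l (z ++ j))) -exprMn.
rewrite ler_sqr ?nnegrE ?mulr_ge0 ?l2norm_ge0 ?sum_mul_le_l2norm //.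
by apply: sumr_ge0 => j _; rewrite mulr_ge0.
Qed.

End Contraction.

(** * Growth of products of exponential vectors *)

Section ExponentialGrowth.
Context (R : realType).
Implicit Types (x t T q : R) (ts : seq R) (n : nat).

Definition exp_sum n x : R := \sum_(j < n) x ^+ j / j`!%:R.

Lemma exp_sum_ge0 n x : 0 <= x -> 0 <= exp_sum n x.
Proof. by move=> x0; apply: sumr_ge0 => j _; rewrite divr_ge0 ?exprn_ge0. Qed.

Lemma cvg_exp_sum x : exp_sum ^~ x @ \oo --> expR x.
Proof.
have -> : exp_sum ^~ x = series (exp_coeff x).
  by apply/funext => n; rewrite /series /= big_mkord.
exact: is_cvg_series_exp_coeff.
Qed.

Lemma exp_sum_le n x : 0 <= x -> exp_sum n x <= expR x.
Proof.
move=> x0; apply: (@cvgr_to_ge _ _ _ R _ _ _ (@cvg_exp_sum x)); near=> m.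
have nm : (n <= m)%N by near: m; exact: nbhs_infty_ge.
rewrite /exp_sum -!(big_mkord xpredT (fun j => x ^+ j / j`!%:R)).
rewrite [leRHS](big_cat_nat (n := n)) //= lerDl sumr_ge0 // => j _.
by rewrite divr_ge0 ?exprn_ge0.
Unshelve. all: by end_near. Qed.

Definition gauss_sum n x : R := \sum_(j < n) x ^+ j / Num.sqrt j`!%:R.

Lemma gauss_sum_ge0 n x : 0 <= x -> 0 <= gauss_sum n x.
Proof.
by move=> x0; apply: sumr_ge0 => j _; rewrite divr_ge0 ?exprn_ge0 ?sqrtr_ge0.
Qed.

Lemma sqrt_fact_neq0 j : Num.sqrt (j`!%:R : R) != 0.
Proof. by rewrite gt_eqF // sqrtr_gt0 ltr0n fact_gt0. Qed.

(** The left-hand side is the diagonal of the square on the right. *)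
Lemma exp_sum_le_gauss_sum n x : 0 <= x -> exp_sum n (x ^+ 2) <= gauss_sum n x ^+ 2.
Proof.
move=> x0; rewrite [leRHS]expr2 {1}/gauss_sum mulr_suml; apply: ler_sum => j _.
rewrite [leRHS]mulrC -[leLHS]mulr1.
have -> : (x ^+ 2) ^+ j / j`!%:R * 1 =
    (x ^+ j / Num.sqrt j`!%:R) * (x ^+ j / Num.sqrt j`!%:R).
  by rewrite mulr1 mulrACA -invfM -!expr2 exprAC sqr_sqrtr.
rewrite ler_wpM2r ?divr_ge0 ?exprn_ge0 ?sqrtr_ge0 // /gauss_sum (bigD1 j) //= lerDl.
by apply: sumr_ge0 => i _; rewrite divr_ge0 ?exprn_ge0 ?sqrtr_ge0.
Qed.

(** Cauchy-Schwarz against the geometric weights [q ^+ j]: for [q] close to one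
    the exponent is nearly that of [exp_sum_le_gauss_sum]. *)
Lemma gauss_sum_sqr_le n x q : 0 <= x -> 0 < q < 1 ->
  gauss_sum n x ^+ 2 <= (1 - q)^-1 * expR (x ^+ 2 / q).
Proof.
move=> x0 /andP[q0 q1].
have sq0 : 0 < Num.sqrt q by rewrite sqrtr_gt0.
pose f (j : 'I_n) := Num.sqrt q ^+ j.
pose g (j : 'I_n) := x ^+ j / (Num.sqrt q ^+ j * Num.sqrt j`!%:R).
have -> : gauss_sum n x = \sum_(j <- index_enum 'I_n) f j * g j.
  apply: eq_bigr => j _; rewrite /f /g invfM [RHS]mulrCA mulVKf //.
  by rewrite expf_neq0 // gt_eqF.
apply: (@le_trans _ _ ((l2norm (index_enum 'I_n) f * l2norm (index_enum 'I_n) g) ^+ 2)).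
  rewrite ler_sqr ?nnegrE ?mulr_ge0 ?l2norm_ge0 ?sum_mul_le_l2norm //.
  by apply: sumr_ge0 => j _; rewrite mulr_ge0 ?divr_ge0 ?mulr_ge0 ?exprn_ge0 ?sqrtr_ge0.
rewrite exprMn !l2norm_sqr ler_pM ?sum_sqr_ge0 //.
  under eq_bigr do rewrite /f exprAC sqr_sqrtr ?(ltW q0) //.
  have h : (1 - q) * \sum_(j < n) q ^+ j = 1 - q ^+ n.
    have := subrXX 1 q n; rewrite expr1n => ->; congr (_ * _).
    by apply: eq_bigr => j _; rewrite expr1n mul1r.
  rewrite -[leRHS]mul1r ler_pdivlMr ?subr_gt0 // mulrC h lerBlDr lerDl exprn_ge0 //.
  exact: ltW.
apply: le_trans (exp_sum_le n _); last by rewrite divr_ge0 ?exprn_ge0 // ltW.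
rewrite le_eqVlt; apply/orP; left; apply/eqP; apply: eq_bigr => j _.
rewrite /g exprMn exprVn exprMn [_ ^+ j ^+ 2]exprAC (exprAC _ j) !sqr_sqrtr ?(ltW q0) //.
by rewrite invfM mulrA -exprVn -exprMn.
Qed.

(** The scalar factors collected when the exponential vectors of parameters
    [T], [t_1], [t_2], etc. are multiplied one after the other, each cross
    exponential being cut off after [n] terms. *)
Fixpoint growth n T ts : R :=
  if ts is t :: ts' then exp_sum n (T * t) * growth n (T + t) ts' else 1.

Fixpoint cross T ts : R :=
  if ts is t :: ts' then T * t + cross (T + t) ts' else 0.

Lemma growth_ge0 n T ts : 0 <= T -> {in ts, forall t, 0 <= t} -> 0 <= growth n T ts.
Proof.
elim: ts T => //= t ts IHts T T0 ts0.
have t0 : 0 <= t by rewrite ts0 ?mem_head.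
rewrite mulr_ge0 ?exp_sum_ge0 ?mulr_ge0 ?IHts ?addr_ge0 // => u uts.
by rewrite ts0 // inE uts orbT.
Qed.

Lemma cvg_growth T ts : growth n T ts @[n --> \oo] --> expR (cross T ts).
Proof.
elim: ts T => [|t ts IHts] T /=; first by rewrite expR0; apply: cvg_cst.
by rewrite expRD; apply: cvgM; [exact: cvg_exp_sum|exact: IHts].
Qed.

Lemma crossE T ts :
  cross T ts *+ 2 = (T + \sum_(t <- ts) t) ^+ 2 - T ^+ 2 - \sum_(t <- ts) t ^+ 2.
Proof.
elim: ts T => [|t ts IHts] T /=; first by rewrite !big_nil addr0 subrr subr0 mul0rn.
by rewrite mulrnDl IHts !big_cons; ring.
Qed.

(** Squaring turns the weights [x ^+ j / sqrt j!] into exponentials; letting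
    the cut-offs tend to infinity leaves an inequality between exponentials of
    quadratic forms, and dilating the parameters compares the quadratic
    forms. *)
Lemma radii_of_growth (k : nat) (sigma C : R) (rho : 'I_k -> R) :
  (0 < k)%N -> 0 < sigma -> (forall i, 0 < rho i) ->
  (forall (t : 'I_k -> R) n, (forall i, 0 <= t i) -> exists N,
     growth n 0 [seq t i | i <- enum 'I_k] * gauss_sum n (sigma * \sum_(i < k) t i)
     <= C * \prod_(i < k) gauss_sum N (rho i * t i)) ->
  \sum_(i < k) (1 + rho i ^+ 2)^-1 <= (1 + sigma ^+ 2)^-1.
Proof.
move=> k0 sigma0 rho0 bound.
pose a i := (1 + rho i ^+ 2)^-1; set S := \sum_(i < k) _.
have r1 i : 0 < 1 + rho i ^+ 2 by rewrite addr_gt0 ?exprn_gt0.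
have a0 i : 0 < a i by rewrite invr_gt0.
have S0 : 0 < S.
  rewrite /S (bigD1 (Ordinal k0)) //= ltr_pwDl ?a0 // sumr_ge0 // => i _.
  exact: ltW (a0 i).
pose A2 := \sum_(i < k) a i ^+ 2; pose B := \sum_(i < k) rho i ^+ 2 * a i ^+ 2.
have SE : S = A2 + B.
  rewrite /A2 /B -big_split; apply: eq_bigr => i _ /=.
  by rewrite -{1}[a i ^+ 2]mul1r -mulrDl [a i ^+ 2]expr2 /a mulVKf // gt_eqF.
have B0 : 0 <= B by apply: sumr_ge0 => i _; rewrite mulr_ge0 ?sqr_ge0.
pose Y := (1 + sigma ^+ 2) * S ^+ 2 - A2.
have expo (q l : R) : 0 < q < 1 -> 0 <= l ->
    expR (l ^+ 2 * (Y - B / q)) <= C ^+ 2 * ((1 - q)^-1) ^+ k.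
  move=> q01 l0; pose t i := l * a i; have t0 i : 0 <= t i by rewrite mulr_ge0 // ltW.
  have tS : \sum_(i < k) t i = l * S by rewrite mulr_sumr.
  have -> : l ^+ 2 * (Y - B / q) = (cross 0 [seq t i | i <- enum 'I_k] *+ 2 +
      (sigma * (l * S)) ^+ 2) - \sum_(i < k) (rho i * t i) ^+ 2 / q.
    have sumE (f : R -> R) :
        \sum_(u <- [seq t i | i <- enum 'I_k]) f u = \sum_(i < k) f (t i).
      by rewrite big_map big_enum.
    rewrite crossE (sumE id) (sumE (fun u => u ^+ 2)) tS.
    have -> : \sum_(i < k) t i ^+ 2 = l ^+ 2 * A2.
      by rewrite mulr_sumr; apply: eq_bigr => i _; rewrite exprMn.
    have -> : \sum_(i < k) (rho i * t i) ^+ 2 / q = l ^+ 2 * B / q.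
      rewrite -mulr_suml mulr_sumr; congr (_ / _); apply: eq_bigr => i _.
      by rewrite !exprMn mulrCA.
    by rewrite /Y; ring.
  rewrite expRB ler_pdivrMr ?expR_gt0 // expR_sum -mulrA.
  have -> : (1 - q)^-1 ^+ k = \prod_(i < k) (1 - q)^-1.
    by rewrite prodr_const card_ord.
  rewrite -big_split /=.
  have lim : (fun n => growth n 0 [seq t i | i <- enum 'I_k] ^+ 2 *
      exp_sum n ((sigma * (l * S)) ^+ 2)) @ \oo -->
      expR (cross 0 [seq t i | i <- enum 'I_k] *+ 2 + (sigma * (l * S)) ^+ 2).
    rewrite expRD mulr2n expRD; apply: cvgM; last exact: cvg_exp_sum.
    by apply: cvgM; exact: cvg_growth.
  apply: (@cvgr_to_le _ _ _ R _ _ _ lim); near=> n.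
  have [N] := bound t n t0; rewrite tS => le1.
  have s0 : 0 <= sigma * (l * S) by rewrite !mulr_ge0 // ltW.
  have g0 : 0 <= growth n 0 [seq t i | i <- enum 'I_k].
    by apply: growth_ge0 => // u /mapP[i _ ->].
  apply: (@le_trans _ _ ((growth n 0 [seq t i | i <- enum 'I_k] *
      gauss_sum n (sigma * (l * S))) ^+ 2)).
    by rewrite [leRHS]exprMn ler_wpM2l ?sqr_ge0 ?exp_sum_le_gauss_sum.
  have lhs0 := mulr_ge0 g0 (gauss_sum_ge0 n s0).
  apply: (@le_trans _ _ ((C * \prod_(i < k) gauss_sum N (rho i * t i)) ^+ 2)).
    by rewrite ler_sqr ?nnegrE // (le_trans lhs0).
  rewrite exprMn ler_wpM2l ?sqr_ge0 // -prodrXl; apply: ler_prod => i _.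
  by rewrite sqr_ge0 gauss_sum_sqr_le // mulr_ge0 // ltW.
(* For a positive [Y - B / q], the dilation making the exponent equal to the
   bound [D] contradicts [1 + D <= expR D]. *)
have Yq q : 0 < q < 1 -> Y - B / q <= 0.
  move=> q01; rewrite leNgt; apply/negP => X0.
  set D := C ^+ 2 * ((1 - q)^-1) ^+ k in expo.
  have D0 : 0 <= D.
    by apply: le_trans (expR_ge0 _) (expo q 0 q01 (lexx 0)).
  have := expo q (Num.sqrt (D / (Y - B / q))) q01 (sqrtr_ge0 _).
  rewrite sqr_sqrtr ?divr_ge0 ?(ltW X0) // divfK ?gt_eqF // -/D.
  by have := expR_ge1Dx D; lra.
(* If [B < Y], any [q] between [B / Y] and one contradicts the previous step. *)
have YB : Y <= B.
  rewrite leNgt; apply/negP => BY.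
  have Y0 : 0 < Y by apply: le_lt_trans BY.
  pose q := (1 + B / Y) / 2.
  have BY1 : B / Y < 1 by rewrite ltr_pdivrMr // mul1r.
  have BY0 : 0 <= B / Y by rewrite divr_ge0 // ltW.
  have q01 : 0 < q < 1 by rewrite /q; lra.
  have q0 : 0 < q by case/andP: q01.
  have := Yq q q01; rewrite subr_le0 ler_pdivlMr // => h.
  have : B < Y * q.
    have : Y * (B / Y) = B by rewrite mulrC divfK // gt_eqF.
    by rewrite /q; move: (B / Y) => z; lra.
  by lra.
have : (1 + sigma ^+ 2) * S ^+ 2 <= S by rewrite SE; move: YB; rewrite /Y -SE; lra.
rewrite [S ^+ 2]expr2 mulrA -[leRHS]mul1r ler_pM2r // => h.
by rewrite -[leRHS]mul1r ler_pdivlMr ?addr_gt0 ?exprn_gt0 // mulrC.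
Unshelve. all: by end_near. Qed.

End ExponentialGrowth.

(** * Operators with finitely many matrix entries *)

Section FiniteSums.
Context (T : choiceType).

Lemma fsbig_finite_support (V : nmodType) (s : seq T) (f : T -> V) : uniq s ->
  (forall x, x \notin s -> f x = 0) ->
  \sum_(x \in [set: T]) f x = \sum_(x <- s) f x.
Proof.
move=> us fs; rewrite (fsbigE s) //; last by move=> x _ /fs.
by apply: eq_bigl => x; rewrite in_setT.
Qed.

Lemma esum_finite_support (R : realType) (s : seq T) (f : T -> R) : uniq s ->
  (forall x, 0 <= f x) -> (forall x, x \notin s -> f x = 0) ->
  \esum_(x in [set: T]) (f x)%:E = (\sum_(x <- s) f x)%:E.
Proof.
move=> us f0 fs.
have -> : \esum_(x in [set: T]) (f x)%:E = \esum_(x in [set` s]) (f x)%:E.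
  rewrite [RHS]esum_mkcond; apply: eq_esum => x _.
  by rewrite mem_setE; case: ifPn => // /fs ->.
rewrite esum_fset //; last by move=> x _; rewrite lee_fin.
by rewrite fsumEFin // -fsbig_seq.
Qed.

End FiniteSums.

Section FiniteOperators.
Context (R : realType) (E : completeNormedModType R[i])
  (dotE : {dot E for Num.conj}) (J : choiceType) (eps : J -> E).
Hypothesis normE : induces_norm dotE.
Hypothesis eps_orthonormal : forall a b, dotE (eps a) (eps b) = (a == b)%:R.
Context (S : seq J).
Hypothesis uS : uniq S.
Implicit Types (v w : E) (A B : E -> E).

Lemma Re_normr (z : R[i]) : (complex.Re `|z|)%:C%C = `|z|.
Proof. by rewrite RRe_real // normr_real. Qed.

Definition real_norm v : R := complex.Re `|v|.

Lemma real_normE v : (real_norm v)%:C%C = `|v|.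
Proof. by rewrite /real_norm RRe_real // normr_real. Qed.

Lemma real_norm_ge0 v : 0 <= real_norm v.
Proof. by rewrite -ler0c real_normE. Qed.

Lemma real_normD v w : real_norm (v + w) <= real_norm v + real_norm w.
Proof. by rewrite -lecR rmorphD /= !real_normE ler_normD. Qed.

Lemma real_normZ (c : R[i]) v :
  real_norm (c *: v) = complex.Re `|c| * real_norm v.
Proof.
apply: complexI; rewrite rmorphM [LHS]real_normE normrZ; congr (_ * _).
exact/esym/real_normE.
Qed.

Lemma real_norm0 : real_norm 0 = 0.
Proof. by rewrite /real_norm normr0. Qed.

Lemma real_norm_sqr v : (real_norm v ^+ 2)%:C%C = dotE v v.
Proof. by rewrite normE -real_normE rmorphXn. Qed.

Lemma real_norm_sum (X : Type) (r : seq X) (P : pred X) (F : X -> E) :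
  real_norm (\sum_(x <- r | P x) F x) <= \sum_(x <- r | P x) real_norm (F x).
Proof.
elim/big_rec2: _ => [|x a v _ h]; first by rewrite real_norm0.
by apply: le_trans (real_normD _ _) _; rewrite lerD2l.
Qed.

Definition proj v : E := \sum_(a <- S) dotE v (eps a) *: eps a.

Lemma proj_linear : linear proj.
Proof.
move=> c v w; rewrite /proj scaler_sumr -big_split; apply: eq_bigr => a _ /=.
by rewrite linearPl scalerDl scalerA.
Qed.

Lemma proj_eps b : proj (eps b) = if b \in S then eps b else 0.
Proof.
rewrite /proj; case: ifPn => bS.
  rewrite (bigD1_seq b) //= eps_orthonormal eqxx scale1r big1 ?addr0 // => a ab.
  by rewrite eps_orthonormal eq_sym (negPf ab) scale0r.
rewrite big1_seq // => a /andP[_ aS]; rewrite eps_orthonormal.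
by case: eqVneq => [ba|_]; rewrite ?scale0r // -ba (negPf bS) in aS *.
Qed.

(** Parseval's identity on the span of the [eps a]. *)
Lemma proj_real_norm_sqr w : proj w = w ->
  real_norm w ^+ 2 = \sum_(a <- S) (complex.Re `|dotE w (eps a)|) ^+ 2.
Proof.
move=> Pw; apply: complexI; rewrite real_norm_sqr -{2}Pw /proj linear_sumr rmorph_sum.
apply: eq_bigr => a _ /=.
transitivity (`|dotE w (eps a)| ^+ 2).
  by rewrite normCK linearZr_LR /= mulrC.
by rewrite -[in LHS]Re_normr rmorphXn.
Qed.

(** Operators living on the span of the [eps a], [a] in [S]: [A = A P = P A]
    with [P] the orthogonal projection.  Unlike a list of matrix entries, this
    form is visibly closed under linear combinations and composition. *)
Definition finite_op A : Prop :=
  [/\ linear A, forall v, A (proj v) = A v & forall v, proj (A v) = A v].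

Lemma linear_map0 A : linear A -> A 0 = 0.
Proof. by move=> lA; have := lA (-1) 0 0; rewrite !scaleN1r !addNr. Qed.

Lemma linear_map_sum A (X : Type) (r : seq X) (P : pred X) (F : X -> E) :
  linear A -> A (\sum_(x <- r | P x) F x) = \sum_(x <- r | P x) A (F x).
Proof.
move=> lA; apply: (big_morph A); last exact: linear_map0.
by move=> v w; have := lA 1 v w; rewrite !scale1r.
Qed.

Lemma linear_mapZ A (c : R[i]) v : linear A -> A (c *: v) = c *: A v.
Proof. by move=> lA; have := lA c v 0; rewrite (linear_map0 lA) !addr0. Qed.

Lemma finite_op0 : finite_op (fun=> 0).
Proof.
split=> // [c v w|v]; first by rewrite scaler0 addr0.
exact: linear_map0 proj_linear.
Qed.

Lemma finite_opZ c A : finite_op A -> finite_op (fun v => c *: A v).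
Proof.
case=> lA AP PA; split=> [d v w|v|v]; last 2 first.
- by rewrite AP.
- by rewrite (linear_mapZ _ _ proj_linear) PA.
by rewrite lA scalerDr !scalerA mulrC.
Qed.

Lemma finite_opD A B : finite_op A -> finite_op B -> finite_op (fun v => A v + B v).
Proof.
case=> lA AP PA [lB BP PB]; split=> [d v w|v|v].
- by rewrite lA lB scalerDr addrACA.
- by rewrite AP BP.
by have := proj_linear 1 (A v) (B v); rewrite !scale1r PA PB.
Qed.

Lemma finite_op_sum (X : Type) (r : seq X) (P : pred X) (F : X -> E -> E) :
  (forall x, P x -> finite_op (F x)) ->
  finite_op (fun v => \sum_(x <- r | P x) F x v).
Proof.
move=> FP; elim: r => [|x r IHr].
  by under eq_fun do rewrite big_nil; exact: finite_op0.
under eq_fun do rewrite big_cons.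
by case Px: (P x) => //; apply: finite_opD => //; apply: FP.
Qed.

Lemma finite_op_comp A B : finite_op A -> finite_op B -> finite_op (A \o B).
Proof.
by case=> lA AP PA [lB BP PB]; split=> [c v w|v|v] /=; rewrite ?lB ?lA ?BP ?PA.
Qed.

Definition hs_norm A : R := l2norm S (fun b => real_norm (A (eps b))).

Lemma hs_norm_ge0 A : 0 <= hs_norm A.
Proof. exact: l2norm_ge0. Qed.

Lemma hs_norm0 A : A =1 (fun=> 0) -> hs_norm A = 0.
Proof.
move=> A0; rewrite /hs_norm /l2norm big1 ?sqrtr0 // => b _.
by rewrite A0 real_norm0 expr0n.
Qed.

Lemma hs_normZ (c : R) A : 0 <= c -> hs_norm (fun v => c%:C%C *: A v) = c * hs_norm A.
Proof.
move=> c0; rewrite /hs_norm -l2normZ //; congr (l2norm _ _); apply/funext => b.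
by rewrite real_normZ ger0_norm // ler0c.
Qed.

Lemma hs_norm_sum (X : Type) (r : seq X) (P : pred X) (F : X -> E -> E) :
  hs_norm (fun v => \sum_(x <- r | P x) F x v) <= \sum_(x <- r | P x) hs_norm (F x).
Proof.
apply: le_trans (l2norm_sum _ _ _ _).
by apply: l2norm_le => b; rewrite real_norm_ge0 real_norm_sum.
Qed.

(** Expanding [w] in the [eps a] and applying Cauchy-Schwarz: the operator norm
    is at most the Hilbert-Schmidt norm. *)
Lemma real_norm_le_hs A w : finite_op A -> proj w = w ->
  real_norm (A w) <= hs_norm A * real_norm w.
Proof.
case=> lA _ _ Pw; rewrite -{1}Pw /proj linear_map_sum //.
apply: le_trans (real_norm_sum _ _ _) _.
under eq_bigr do rewrite linear_mapZ // real_normZ.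
apply: le_trans (sum_mul_le_l2norm _ _ _) _.
rewrite mulrC ler_wpM2l ?l2norm_ge0 // -ler_sqr ?nnegrE ?l2norm_ge0 ?real_norm_ge0 //.
by rewrite l2norm_sqr proj_real_norm_sqr.
Qed.

Lemma hs_norm_comp A B : finite_op A -> finite_op B ->
  hs_norm (A \o B) <= hs_norm A * hs_norm B.
Proof.
move=> fA fB; rewrite -l2normZ ?hs_norm_ge0 //; apply: l2norm_le => b.
rewrite real_norm_ge0 /=; apply: real_norm_le_hs fA _.
by case: fB => _ _ PB; rewrite PB.
Qed.

Lemma HS_norm2E A : finite_op A -> HS_norm2 dotE eps A = (hs_norm A ^+ 2)%:E.
Proof.
case=> lA AP PA; rewrite l2norm_sqr -esum_finite_support //.
- by apply: eq_esum => b _; rewrite -real_norm_sqr.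
- by move=> b; rewrite sqr_ge0.
by move=> b bS; rewrite -AP proj_eps (negPf bS) (linear_map0 lA) real_norm0 expr0n.
Qed.

Lemma finite_op_of_matrix (s : seq (R[i] * (J * J))) A :
  {subset [seq t.2.1 | t <- s] <= S} -> {subset [seq t.2.2 | t <- s] <= S} ->
  (forall v, A v = \sum_(t <- s) (t.1 * dotE v (eps t.2.2)) *: eps t.2.1) ->
  finite_op A.
Proof.
move=> s1 s2 AE.
have Pd b v : b \in S -> dotE (proj v) (eps b) = dotE v (eps b).
  move=> bS; rewrite /proj linear_sumlz (bigD1_seq b) //= linearZl_LR /=.
  rewrite eps_orthonormal eqxx mulr1 big1 ?addr0 // => a ab.
  by rewrite linearZl_LR /= eps_orthonormal (negPf ab) mulr0.
split=> [c v w|v|v]; rewrite !AE.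
- rewrite scaler_sumr -big_split; apply: eq_bigr => t _ /=.
  by rewrite scalerA -scalerDl linearPl /= mulrDr mulrCA.
- by apply: eq_big_seq => t ts; rewrite Pd //; apply: s2; apply: (map_f (fun t => t.2.2)).
rewrite (linear_map_sum _ _ _ proj_linear); apply: eq_big_seq => t ts.
rewrite (linear_mapZ _ _ proj_linear) proj_eps s1 //.
exact: (map_f (fun t => t.2.1)).
Qed.

End FiniteOperators.

(** * Chaoses with finitely many nonzero coefficients *)

Lemma degree_split (m n r : nat) : (r <= m)%N -> (r <= n)%N ->
  ((m - r) + (n - r) = m + n - r.*2)%N.
Proof. lia. Qed.

Lemma degree_lt (N : nat) (m n : 'I_N) (r : nat) : (m + n - r.*2 < N + N)%N.
Proof. by have := ltn_ord m; have := ltn_ord n; lia. Qed.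

Section FiniteChaos.
Context (R : realType) (H : completeNormedModType R) (dotH : {dot H for idfun}).
Context (E : completeNormedModType R[i]) (dotE : {dot E for Num.conj}).
Context (I J : choiceType) (e : I -> H) (eps : J -> E).
Hypothesis normE : induces_norm dotE.
Hypothesis eps_orthonormal : forall a b, dotE (eps a) (eps b) = (a == b)%:R.
Context (F : seq I) (S : seq J) (i0 : I).
Hypotheses (uS : uniq S) (i0F : i0 \in F).
Implicit Types (K L : chaos H E) (i : seq I) (v : E) (m n r d N : nat).

Let T : finType := seq_sub F.
Let t0 : T := SeqSub i0F.

(** Only the values on basis words enter the norms and the products, and for
    these values finiteness in the degree, in the letters and in the matrix
    entries is stable under products, with the same [F] and [S]. *)
Record finite_chaos N K : Prop := {
  finite_degree : forall i v, (N <= size i)%N -> K (map e i) v = 0;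
  finite_support : forall i v, ~~ all (mem F) i -> K (map e i) v = 0;
  finite_value : forall i, finite_op dotE eps S (K (map e i)) }.

Lemma finite_chaos_le N N' K : (N <= N')%N -> finite_chaos N K -> finite_chaos N' K.
Proof. by move=> NN' [deg sup val]; split=> // i v /(leq_trans NN')/deg. Qed.

Lemma finite_chaos0 N K i : finite_chaos N K -> K (map e i) 0 = 0.
Proof. by case=> _ _ /(_ i)[lK _ _]; apply: linear_map0. Qed.

Definition words d : seq (d.-tuple I) :=
  [seq map_tuple val w | w : d.-tuple T].

Lemma words_uniq d : uniq (words d).
Proof.
rewrite map_inj_uniq ?enum_uniq // => w w' /(congr1 val) /= ww'.
by apply: val_inj; apply: inj_map ww'; apply: val_inj.
Qed.

Lemma mem_words d (w : d.-tuple I) : (w \in words d) = all (mem F) w.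
Proof.
apply/mapP/allP => [[u _ ->] x /mapP[y _ ->]|wF]; first exact: valP.
exists [tuple insubd t0 (tnth w l) | l < d]; first by rewrite mem_enum.
apply: eq_from_tnth => l; rewrite tnth_map tnth_mktuple val_insubd.
by have /= -> := wF _ (mem_tnth l w).
Qed.

Lemma fsbig_words (V : nmodType) d (f : seq I -> V) :
  (forall i, ~~ all (mem F) i -> f i = 0) ->
  \sum_(w \in [set: d.-tuple I]) f w = \sum_(w : d.-tuple T) f (map val w).
Proof.
move=> f0; rewrite (fsbig_finite_support (words_uniq d)).
  by rewrite big_map big_enum.
by move=> w; rewrite mem_words => /f0.
Qed.

Definition coef_norm K (w : seq T) : R := hs_norm eps S (K (map e (map val w))).

Lemma coef_norm_ge0 K w : 0 <= coef_norm K w.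
Proof. exact: hs_norm_ge0. Qed.

Lemma kernel_normE N K m : finite_chaos N K ->
  kernel_norm dotE e eps m K = (word_norm m (coef_norm K))%:E.
Proof.
case=> _ sup val; rewrite /kernel_norm.
under eq_esum do rewrite (HS_norm2E normE eps_orthonormal uS (val _)).
rewrite (esum_finite_support (words_uniq m)).
- by rewrite big_map big_enum.
- by move=> w; rewrite sqr_ge0.
by move=> w; rewrite mem_words => /sup K0; rewrite hs_norm0 ?expr0n.
Qed.

Definition real_chaos_norm (rho : R) N K : R :=
  \sum_(m < N) rho ^+ m * Num.sqrt m`!%:R * word_norm m (coef_norm K).

Lemma chaos_normE N K (rho : R) : finite_chaos N K ->
  chaos_norm dotE e eps rho K = (real_chaos_norm rho N K)%:E.
Proof.
move=> fK; rewrite /chaos_norm; apply: lim_near_cst => //; near=> p.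
have Np : (N <= p)%N by near: p; exact: nbhs_infty_ge.
rewrite (big_cat_nat (n := N)) //= [X in (_ + X)%E]big1_seq ?adde0.
  rewrite big_mkord -sumEFin; apply: eq_bigr => m _.
  by rewrite (kernel_normE _ fK).
move=> m /andP[_]; rewrite mem_index_iota => /andP[Nm _].
rewrite (kernel_normE _ fK) /word_norm /l2norm big1 ?sqrtr0 ?mule0 // => w _.
rewrite /coef_norm hs_norm0 ?expr0n // => v.
by apply: (finite_degree fK); rewrite size_map size_tuple.
Unshelve. all: by end_near. Qed.

Lemma sum_permute (x : seq H) d (g : seq H -> E) : size x = d ->
  \sum_(s : 'S_(size x)) g (permute s) =
  \sum_(s : 'S_d) g (permuted (e i0) s x).
Proof.
move=> <-; apply: eq_bigr => s _; congr g; apply: eq_map => l.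
by rewrite (tnth_nth (e i0)).
Qed.

Lemma permuted_map (U V : Type) (f : U -> V) (x0 : U) d (s : 'S_d) (x : seq U) :
  size x = d -> permuted (f x0) s (map f x) = map f (permuted x0 s x).
Proof.
by move=> xd; rewrite -map_comp; apply: eq_map => l /=; rewrite (nth_map x0) ?xd.
Qed.

Lemma symmetrize_basis (G : chaos H E) i d v : size i = d ->
  symmetrize G (map e i) v =
  (d`!%:R^-1)%:C%C *: \sum_(s : 'S_d) G (map e (permuted i0 s i)) v.
Proof.
move=> id; rewrite /symmetrize (@sum_permute _ d (fun x => G x v)).
  rewrite size_map id fmorphV rmorph_nat; congr (_ *: _).
  by apply: eq_bigr => s _; rewrite permuted_map.
by rewrite size_map.
Qed.

Lemma all_permuted d (s : 'S_d) i : size i = d ->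
  all (mem F) (permuted i0 s i) = all (mem F) i.
Proof.
move=> id; apply/allP/(all_nthP i0) => [pF l|iF x /mapP[l _ ->]].
  rewrite id => ld; apply: pF; apply/mapP; exists (s^-1%g (Ordinal ld)).
    by rewrite mem_enum.
  by rewrite permKV.
by apply: iF; rewrite id.
Qed.

Section Star.
Context (N : nat) (K L : chaos H E).
Hypotheses (fK : finite_chaos N K) (fL : finite_chaos N L).

Definition contracted p i j v : E :=
  K (map e (take p i ++ j)) (L (map e (drop p i ++ j)) v).

Lemma contracted_op p i j : finite_op dotE eps S (contracted p i j).
Proof.
exact: finite_op_comp (finite_value fK _) (finite_value fL _).
Qed.

(** A letter outside [F] stands in the argument of [K] or in that of [L]; in
    the second case [K] is applied to the vector zero. *)
Lemma contracted_support p i j v : ~~ all (mem F) (i ++ j) -> contracted p i j v = 0.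
Proof.
rewrite -{1}(cat_take_drop p i) !all_cat /contracted => h.
have [c|c] := boolP (all (mem F) (drop p i ++ j)).
  apply: (finite_support fK); move: c; rewrite !all_cat => /andP[c1 c2].
  by move: h; rewrite c1 c2 !andbT.
by rewrite (finite_support fL) // (finite_chaos0 _ fK).
Qed.

Lemma contracted_degree m n r i (j : r.-tuple I) v :
  (r <= m)%N -> (r <= n)%N -> (m + n - r.*2 = size i)%N -> (N <= maxn m n)%N ->
  contracted (m - r) i j v = 0.
Proof.
move=> rm rn mn; rewrite leq_max /contracted => /orP[Nm|Nn].
  apply: (finite_degree fK); rewrite size_cat size_tuple size_takel ?subnK //.
  by rewrite -mn -degree_split // leq_addr.
rewrite (finite_degree fL) ?(finite_chaos0 _ fK) //.
by rewrite size_cat size_tuple size_drop -mn -degree_split // addKn subnK.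
Qed.

Definition star_index (d : nat) (t : 'I_N * 'I_N * 'I_N) : bool :=
  [&& (t.2 <= t.1.1)%N, (t.2 <= t.1.2)%N & (t.1.1 + t.1.2 - (t.2 : nat).*2 == d)%N].

Definition star_coef (t : 'I_N * 'I_N * 'I_N) : nat :=
  t.2`! * 'C(t.1.1, t.2) * 'C(t.1.2, t.2).

Lemma sym_contraction_basis m n r i v d : size i = d ->
  (r <= m)%N -> (r <= n)%N -> (m + n - r.*2 = d)%N ->
  sym_contraction e r m K L (map e i) v =
  (d`!%:R^-1)%:C%C *: \sum_(s : 'S_d) \sum_(j : r.-tuple T)
     contracted (m - r) (permuted i0 s i) (map val j) v.
Proof.
move=> id rm rn mn; rewrite /sym_contraction (symmetrize_basis _ _ id).
congr (_ *: _); apply: eq_bigr => s _.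
rewrite -(fsbig_words _ (f := fun j => contracted (m - r) (permuted i0 s i) j v)).
  by apply: eq_fsbigr => j _; rewrite /contracted !map_cat map_take map_drop.
by move=> j jF; apply: contracted_support; rewrite all_cat negb_and jF orbT.
Qed.

Lemma sym_contraction_degree m n r i v :
  (r <= m)%N -> (r <= n)%N -> (m + n - r.*2 = size i)%N -> (N <= maxn m n)%N ->
  sym_contraction e r m K L (map e i) v = 0.
Proof.
move=> rm rn mn Nmn.
rewrite (sym_contraction_basis _ (erefl _) rm rn mn) big1 ?scaler0 // => s _.
rewrite big1 // => j _.
by apply: (@contracted_degree m n r _ (map_tuple val j)); rewrite ?size_permuted.
Qed.

Definition star_sum d i v : E :=
  \sum_(t | star_index d t) (star_coef t)%:R%:C%C *:
    ((d`!%:R^-1)%:C%C *: \sum_(s : 'S_d) \sum_(j : t.2.-tuple T)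
      contracted (t.1.1 - t.2) (permuted i0 s i) (map val j) v).

Lemma star_basis i d : size i = d -> star e K L (map e i) = star_sum d i.
Proof.
move=> id; apply/funext => v; rewrite /star fsbig_mkcond /star_sum.
pose f (t : 'I_N * 'I_N * 'I_N) : nat * nat * nat := (t.1.1 : nat, t.1.2 : nat, t.2 : nat).
have f_inj : injective f.
  by move=> [[a b] c] [[a' b'] c'] [/val_inj -> /val_inj -> /val_inj ->].
have uf : uniq [seq f t | t <- enum {: 'I_N * 'I_N * 'I_N}].
  by rewrite map_inj_uniq ?enum_uniq.
rewrite (fsbig_finite_support uf).
  rewrite big_map big_enum [RHS]big_mkcond /=; apply: eq_bigr => -[[m n] r] _.
  rewrite /patch /star_index /star_coef /=; case: ifPn; rewrite ?inE ?notin_setE /= => A.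
    case: A => rm rn mn; rewrite size_map id in mn; rewrite rm rn mn eqxx /=.
    by rewrite (sym_contraction_basis _ id rm rn mn) rmorph_nat.
  case: ifP => // /and3P[rm rn /eqP mn]; case: A; split=> //.
  by rewrite size_map id.
move=> [[m n] r] tf; rewrite /patch; case: ifP => //; rewrite inE /= => -[rm rn mn].
rewrite size_map in mn; rewrite (sym_contraction_degree _ rm rn mn) ?scaler0 //.
rewrite leqNgt gtn_max; apply/negP => /andP[mN nN].
case/mapP: tf; exists (Ordinal mN, Ordinal nN, Ordinal (leq_ltn_trans rm mN)) => //.
by rewrite mem_enum.
Qed.

Lemma finite_chaos_star : finite_chaos (N + N) (star e K L).
Proof.
split=> [i v Ni|i v iF|i].
- rewrite (star_basis (erefl _)) /star_sum big1 // => -[[m n] r] /and3P[/= _ _ /eqP mn].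
  by move: Ni; rewrite leqNgt -mn degree_lt.
- rewrite (star_basis (erefl _)) /star_sum big1 // => t _.
  rewrite big1 ?scaler0 // => s _; rewrite big1 // => j _.
  by apply: contracted_support; rewrite all_cat negb_and all_permuted ?iF.
rewrite (star_basis (erefl _)).
apply: finite_op_sum => t _; apply: finite_opZ; apply: finite_opZ.
apply: finite_op_sum => s _; apply: finite_op_sum => j _; exact: contracted_op.
Qed.

Lemma coef_norm_star d (w : d.-tuple T) :
  coef_norm (star e K L) w <=
  \sum_(t | star_index d t) (star_coef t)%:R * (d`!%:R^-1 *
    \sum_(s : 'S_d) contraction (t.1.1 - t.2) t.2 (coef_norm K) (coef_norm L)
                      (permuted t0 s w)).
Proof.
have wd : size (map val w) = d by rewrite size_map size_tuple.
rewrite /coef_norm (star_basis wd).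
apply: le_trans (hs_norm_sum _ _ _ _ _) _; apply: ler_sum => t _.
rewrite !hs_normZ ?invr_ge0 // ler_wpM2l // ler_wpM2l ?invr_ge0 //.
apply: le_trans (hs_norm_sum _ _ _ _ _) _; apply: ler_sum => s _.
apply: le_trans (hs_norm_sum _ _ _ _ _) _; apply: ler_sum => j _.
rewrite (permuted_map val t0) ?size_tuple // /contracted.
rewrite -map_take -map_drop -!map_cat.
exact: (hs_norm_comp normE (finite_value fK _) (finite_value fL _)).
Qed.

(** By Minkowski's inequality the l2 norm passes inside the sums; there each
    permutation of the letters only rearranges the words, so that the average
    over permutations disappears. *)
Lemma word_norm_star d :
  word_norm d (coef_norm (star e K L)) <=
  \sum_(t | star_index d t) (star_coef t)%:R *
    (word_norm t.1.1 (coef_norm K) * word_norm t.1.2 (coef_norm L)).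
Proof.
have conv0 p r u : 0 <= contraction p r (coef_norm K) (coef_norm L) u.
  by apply: sumr_ge0 => j _; rewrite mulr_ge0 ?coef_norm_ge0.
apply: le_trans (l2norm_le (g := fun w : d.-tuple T => \sum_(t | star_index d t)
   (star_coef t)%:R * (d`!%:R^-1 * \sum_(s : 'S_d) contraction (t.1.1 - t.2) t.2
     (coef_norm K) (coef_norm L) (permuted t0 s w))) _ _) _.
  by move=> w; rewrite coef_norm_ge0 coef_norm_star.
apply: le_trans (l2norm_sum _ _ _ _) _; apply: ler_sum => t /and3P[rm rn /eqP mn].
rewrite l2normZ // ler_wpM2l // l2normZ ?invr_ge0 //.
apply: (@le_trans _ _ (d`!%:R^-1 * \sum_(s : 'S_d)
    word_norm t.1.1 (coef_norm K) * word_norm t.1.2 (coef_norm L))).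
  rewrite ler_wpM2l ?invr_ge0 //.
  apply: le_trans (l2norm_sum _ _ _ _) _; apply: ler_sum => s _.
  rewrite /l2norm (sum_permuted t0 s (fun u =>
    contraction (t.1.1 - t.2) t.2 (coef_norm K) (coef_norm L) u ^+ 2)).
  have := word_norm_contraction (t.1.1 - t.2) (t.1.2 - t.2) t.2
    (coef_norm_ge0 K) (coef_norm_ge0 L).
  by rewrite !subnK // degree_split // mn.
set x := word_norm _ _ * _; rewrite sumr_const card_Sn.
have -> : x *+ d`! = d`!%:R * x by rewrite mulr_natl.
by rewrite mulKf // pnatr_eq0 -lt0n fact_gt0.
Qed.

End Star.
End FiniteChaos.

(** * Submultiplicativity of the chaos norms *)

Section Submultiplicative.
Context (R : realType) (H : completeNormedModType R) (dotH : {dot H for idfun}).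
Context (E : completeNormedModType R[i]) (dotE : {dot E for Num.conj}).
Context (I J : choiceType) (e : I -> H) (eps : J -> E).
Hypothesis normE : induces_norm dotE.
Hypothesis eps_orthonormal : forall a b, dotE (eps a) (eps b) = (a == b)%:R.
Context (F : seq I) (S : seq J) (i0 : I).
Hypotheses (uS : uniq S) (i0F : i0 \in F).
Implicit Types (K L : chaos H E) (N : nat) (rho tau : R).

Local Notation fchaos := (finite_chaos dotE e eps F S).
Local Notation rnorm := (real_chaos_norm e eps F S).
Local Notation wnorm d K := (word_norm d (coef_norm e eps S (F := F) K)).

Lemma word_norm_ge0 d K : 0 <= wnorm d K.
Proof. exact: l2norm_ge0. Qed.

Lemma real_chaos_norm_star N K L rho1 rho2 tau :
  fchaos N K -> fchaos N L -> 0 < rho1 -> 0 < rho2 -> 0 < tau ->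
  (1 + rho1 ^+ 2)^-1 + (1 + rho2 ^+ 2)^-1 = (1 + tau ^+ 2)^-1 ->
  rnorm tau (N + N) (star e K L) <=
  rnorm rho1 N K * rnorm rho2 N L.
Proof.
move=> fK fL rho1_gt0 rho2_gt0 tau_gt0 radii.
pose a d := tau ^+ d * Num.sqrt d`!%:R.
have a0 d : 0 <= a d by rewrite mulr_ge0 ?exprn_ge0 ?sqrtr_ge0 // ltW.
pose kl (m n : nat) := wnorm m K * wnorm n L.
apply: (@le_trans _ _ (\sum_(d < N + N) \sum_(t | @star_index N d t)
    a d * ((star_coef t)%:R * kl t.1.1 t.1.2))).
  apply: ler_sum => d _; rewrite -mulr_sumr (ler_wpM2l (a0 d)) //.
  exact: (word_norm_star normE i0F fK fL).
under eq_bigr do rewrite big_mkcond.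
(* A triple [(m, n, r)] contributes to the single degree [m + n - 2 r]. *)
rewrite exchange_big /=.
pose b (m n r : nat) := (r`! * 'C(m, r) * 'C(n, r))%:R * a (m + n - r.*2)%N.
apply: (@le_trans _ _ (\sum_(m < N) \sum_(n < N)
    (\sum_(r < N | (r <= m)%N && (r <= n)%N) b m n r) * kl m n)); last first.
  rewrite /real_chaos_norm big_distrlr /=.
  apply: ler_sum => m _; apply: ler_sum => n _.
  rewrite [leRHS]mulrACA ler_wpM2r ?mulr_ge0 ?word_norm_ge0 //.
  exact: two_factor_scalar.
rewrite [leRHS]pair_big /= [leRHS](eq_bigr (fun mn : 'I_N * 'I_N => \sum_(r < N)
   if (r <= mn.1)%N && (r <= mn.2)%N then b mn.1 mn.2 r * kl mn.1 mn.2 else 0)).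
  rewrite [leRHS]pair_big /=; apply: ler_sum => -[[m n] r] _ /=.
  rewrite (bigD1 (Ordinal (degree_lt m n r))) //= big1 => [|d dm].
    rewrite addr0 /star_index /star_coef /= eqxx andbT; case: ifP => // _.
    by rewrite /b mulrCA mulrA.
  rewrite /star_index /=; case: ifP => // /and3P[_ _ /eqP dE].
  by move: dm; rewrite -val_eqE /= dE eqxx.
by move=> mn _; rewrite mulr_suml big_mkcond.
Qed.

Lemma chaos_norm_ge0 N K rho : fchaos N K -> 0 <= rho ->
  (0 <= chaos_norm dotE e eps rho K)%E.
Proof.
move=> fK rho0; rewrite (chaos_normE normE eps_orthonormal uS i0F _ fK) lee_fin.
apply: sumr_ge0 => m _.
by rewrite !mulr_ge0 ?exprn_ge0 ?sqrtr_ge0 // word_norm_ge0.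
Qed.

Lemma chaos_norm_star N K L rho1 rho2 tau :
  fchaos N K -> fchaos N L -> 0 < rho1 -> 0 < rho2 -> 0 < tau ->
  (1 + rho1 ^+ 2)^-1 + (1 + rho2 ^+ 2)^-1 = (1 + tau ^+ 2)^-1 ->
  (chaos_norm dotE e eps tau (star e K L) <=
   chaos_norm dotE e eps rho1 K * chaos_norm dotE e eps rho2 L)%E.
Proof.
move=> fK fL rho1_gt0 rho2_gt0 tau_gt0 radii.
have fKL := finite_chaos_star i0F fK fL.
rewrite (chaos_normE normE eps_orthonormal uS i0F _ fK).
rewrite (chaos_normE normE eps_orthonormal uS i0F _ fL).
rewrite (chaos_normE normE eps_orthonormal uS i0F _ fKL) -EFinM lee_fin.
exact: real_chaos_norm_star.
Qed.

Lemma chaos_norm_le_radius N K rho tau : fchaos N K -> 0 < rho -> 0 < tau ->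
  (1 + rho ^+ 2)^-1 <= (1 + tau ^+ 2)^-1 ->
  (chaos_norm dotE e eps tau K <= chaos_norm dotE e eps rho K)%E.
Proof.
move=> fK rho0 tau0; rewrite lef_pV2 ?posrE ?addr_gt0 ?exprn_gt0 // lerD2l.
rewrite ler_sqr ?nnegrE ?(ltW rho0) ?(ltW tau0) // => tau_rho.
rewrite !(chaos_normE normE eps_orthonormal uS i0F _ fK) lee_fin.
apply: ler_sum => m _; rewrite ler_wpM2r ?word_norm_ge0 // ler_wpM2r ?sqrtr_ge0 //.
by rewrite lerXn2r // nnegrE ltW.
Qed.

(** The quantities [(1 + rho ^+ 2)^-1] add up along a product, so that the
    factors can be absorbed one at a time: the partial products are measured
    in the radius whose quantity is the partial sum. *)
Lemma chaos_norm_foldl (X : Type) (s : seq X) (Ks : X -> chaos H E) (rhos : X -> R)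
    N K rho tau :
  fchaos N K -> (forall x, exists N', fchaos N' (Ks x)) ->
  0 < rho -> (forall x, 0 < rhos x) -> 0 < tau ->
  (1 + rho ^+ 2)^-1 + \sum_(x <- s) (1 + rhos x ^+ 2)^-1 <= (1 + tau ^+ 2)^-1 ->
  (chaos_norm dotE e eps tau (foldl (star e) K [seq Ks x | x <- s]) <=
   chaos_norm dotE e eps rho K * \prod_(x <- s) chaos_norm dotE e eps (rhos x) (Ks x))%E.
Proof.
move=> fK fKs rho0 rhos0 tau0.
elim: s N K rho fK rho0 => [|x s IHs] N K rho fK rho0 /=.
  rewrite !big_nil addr0 mule1; exact: chaos_norm_le_radius fK rho0 tau0.
rewrite big_cons addrA => radii.
set c := (1 + rho ^+ 2)^-1 + (1 + rhos x ^+ 2)^-1 in radii.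
have inv0 (y : R) : 0 < (1 + y ^+ 2)^-1.
  by rewrite invr_gt0 ltr_pwDl ?sqr_ge0.
have c0 : 0 < c by rewrite addr_gt0.
have c1 : c < 1.
  apply: (@le_lt_trans _ _ (1 + tau ^+ 2)^-1).
    apply: le_trans radii; rewrite lerDl sumr_ge0 // => y _; exact: ltW.
  by rewrite invf_lt1 ?ltrDl ?exprn_gt0 // addr_gt0 ?exprn_gt0.
pose rho' := Num.sqrt (c^-1 - 1).
have c'0 : 0 < c^-1 - 1 by rewrite subr_gt0 invf_gt1.
have rho'0 : 0 < rho' by rewrite sqrtr_gt0.
have rho'E : (1 + rho' ^+ 2)^-1 = c.
  by rewrite sqr_sqrtr ?(ltW c'0) // addrC subrK invrK.
have [N' fx] := fKs x.
have fKm := finite_chaos_le (leq_maxl N N') fK.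
have fxm := finite_chaos_le (leq_maxr N N') fx.
have fKx := finite_chaos_star i0F fKm fxm.
apply: le_trans (IHs _ _ rho' fKx rho'0 _) _; first by rewrite rho'E.
rewrite big_cons muleA lee_wpmul2r //.
  apply: prode_ge0 => y _; have [Ny fy] := fKs y.
  by apply: chaos_norm_ge0 fy _; rewrite ltW.
by apply: chaos_norm_star fKm fxm _ _ _ _.
Qed.

End Submultiplicative.

(** * The finite core *)

Section FiniteCore.
Context (R : realType) (H : completeNormedModType R) (dotH : {dot H for idfun}).
Context (E : completeNormedModType R[i]) (dotE : {dot E for Num.conj}).
Context (I J : choiceType) (e : I -> H) (eps : J -> E).
Hypothesis e_orthonormal : forall a b, dotH (e a) (e b) = (a == b)%:R.
Hypothesis eps_orthonormal : forall a b, dotE (eps a) (eps b) = (a == b)%:R.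
Implicit Types (K : chaos H E) (A : E -> E) (v : E) (F : seq I) (S : seq J).

Lemma elementary_basis (h i : seq I) A v :
  elementary dotH (map e h) A (map e i) v = if i == h then A v else 0.
Proof.
rewrite /elementary !size_map; case: eqP => [hi|/eqP hi]; last first.
  by case: eqP => // ih; rewrite ih eqxx in hi.
have -> : \prod_(p <- zip (map e h) (map e i)) dotH p.1 p.2 = (i == h)%:R.
  elim: h i hi => [|a h IHh] [|b i] //= => [_|[hi]]; first by rewrite big_nil.
  by rewrite big_cons IHh // e_orthonormal eqseq_cons [b == a]eq_sym -natrM mulnb.
by case: eqP => _; rewrite ?scale1r ?scale0r.
Qed.

Lemma symmetrize_elementary_basis (i0 : I) (h i : seq I) A v :
  symmetrize (elementary dotH (map e h) A) (map e i) v =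
  (((size i)`!%:R^-1)%:C%C * \sum_(s : 'S_(size i)) (permuted i0 s i == h)%:R) *: A v.
Proof.
rewrite (symmetrize_basis e i0 _ _ (erefl (size i))) -scalerA; congr (_ *: _).
rewrite scaler_suml; apply: eq_bigr => s _; rewrite elementary_basis.
by case: eqP; rewrite ?scale1r ?scale0r.
Qed.

(** Finitely many basis vectors of [H] and of [E] carry each degree of an
    element of the finite core, hence the whole of it. *)
Lemma finite_core_chaos (i0 : I) K : finite_core dotH dotE e eps K ->
  exists NFS : nat * seq I * seq J, forall F S,
    uniq S -> {subset NFS.1.2 <= F} -> {subset NFS.2 <= S} ->
    finite_chaos dotE e eps F S NFS.1.1 K.
Proof.
case=> -[N KN] Km.
have /choice[FS FSP] : forall m, exists FS : seq I * seq J, forall F S,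
    uniq S -> {subset FS.1 <= F} -> {subset FS.2 <= S} -> forall i, size i = m ->
    finite_op dotE eps S (K (map e i)) /\
    (~~ all (mem F) i -> forall v, K (map e i) v = 0).
  move=> m; have [n [h [A [fA KE]]]] := Km m.
  have [s sP] := choice fA.
  exists (flatten [seq tval (h l) | l <- enum 'I_n],
          flatten [seq map (fun t => t.2.1) (s l) ++ map (fun t => t.2.2) (s l)
                  | l <- enum 'I_n]) => F S uS hF hS i im.
  have KiE v : K (map e i) v = \sum_(l < n) (((size i)`!%:R^-1)%:C%C *
      \sum_(p : 'S_(size i)) (permuted i0 p i == h l)%:R) *: A l v.
    rewrite KE ?size_map //; apply: eq_bigr => l _.
    exact: symmetrize_elementary_basis.
  split=> [|iF v].
    rewrite (_ : K (map e i) = fun v => \sum_(l < n) (((size i)`!%:R^-1)%:C%C *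
      \sum_(p : 'S_(size i)) (permuted i0 p i == h l)%:R) *: A l v); last exact/funext.
    apply: finite_op_sum => l _; apply: finite_opZ.
    apply: (finite_op_of_matrix eps_orthonormal uS _ _ (sP l)) => b bs; apply: hS;
      apply/flattenP; exists (map (fun t => t.2.1) (s l) ++ map (fun t => t.2.2) (s l));
      by [apply/mapP; exists l; rewrite ?mem_enum | rewrite mem_cat bs ?orbT].
  rewrite KiE big1 // => l _; rewrite big1 ?mulr0 ?scale0r // => p _.
  case: eqP => // ph; move: iF; rewrite -(all_permuted F i0 p (erefl _)) ph.
  case/negP; apply/allP => x xh; apply: hF; apply/flattenP; exists (tval (h l)) => //.
  by apply/mapP; exists l; rewrite ?mem_enum.
exists (N, flatten [seq (FS m).1 | m <- iota 0 N], flatten [seq (FS m).2 | m <- iota 0 N]).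
move=> F S uS /= hF hS.
have deg i v : (N <= size i)%N -> K (map e i) v = 0.
  by move=> Ni; apply: KN; rewrite size_map.
have sub i : (size i < N)%N -> finite_op dotE eps S (K (map e i)) /\
    (~~ all (mem F) i -> forall v, K (map e i) v = 0).
  move=> iN; have iN' : size i \in iota 0 N by rewrite mem_iota.
  apply: (FSP (size i)) => // x xFS.
    by apply: hF; apply/flattenP; exists (FS (size i)).1 => //; apply/mapP; exists (size i).
  by apply: hS; apply/flattenP; exists (FS (size i)).2 => //; apply/mapP; exists (size i).
split=> // [i v iF|i]; have [/sub[fi Ki]|Ni] := ltnP (size i) N.
- exact: Ki.
- exact: deg.
- exact: fi.
by rewrite (_ : K (map e i) = fun=> 0); [exact: finite_op0|apply/funext => v; exact: deg].
Qed.

End FiniteCore.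

Lemma finite_core_chaoses (R : realType) (H : completeNormedModType R)
    (dotH : {dot H for idfun}) (E : completeNormedModType R[i])
    (dotE : {dot E for Num.conj}) (I J : choiceType) (e : I -> H) (eps : J -> E)
    (k : nat) (Ks : 'I_k -> chaos H E) (i0 : I) :
  (forall a b, dotH (e a) (e b) = (a == b)%:R) ->
  (forall a b, dotE (eps a) (eps b) = (a == b)%:R) ->
  (forall l, finite_core dotH dotE e eps (Ks l)) ->
  exists (F : seq I) (S : seq J), [/\ uniq S, i0 \in F &
    forall l, exists N, finite_chaos dotE e eps F S N (Ks l)].
Proof.
move=> he heps core.
have /choice[f fP] := fun l => finite_core_chaos he heps i0 (core l).
exists (i0 :: flatten [seq (f l).1.2 | l <- enum 'I_k]).
exists (undup (flatten [seq (f l).2 | l <- enum 'I_k])).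
split; rewrite ?undup_uniq ?mem_head // => l; exists (f l).1.1.
apply: fP; rewrite ?undup_uniq // => x xf.
  rewrite inE; apply/orP; right; apply/flattenP; exists (f l).1.2 => //.
  by apply/mapP; exists l; rewrite ?mem_enum.
rewrite mem_undup; apply/flattenP; exists (f l).2 => //.
by apply/mapP; exists l; rewrite ?mem_enum.
Qed.

(** * Products of truncated exponential vectors *)

Section ExponentialCoefficients.
Context (R : realType).
Implicit Types (t T a : R) (c : nat -> R) (d m n N M : nat).

Definition star_coefs N c c' (d : nat) : R :=
  \sum_(t | @star_index N d t) (star_coef t)%:R * (c t.1.1 * c' t.1.2).

Definition exp_coefs t M m : R := if (m < M)%N then t ^+ m / m`!%:R else 0.

(** [fun m => T ^+ m / m!] are the coefficients of the exponential vector of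
    parameter [T]. Domination is only asked below the degree [M] because the
    factors are truncated; nonnegativity everywhere makes it stable under
    products. *)
Definition dominates a T M c : Prop :=
  (forall m, 0 <= c m) /\ (forall m, (m < M)%N -> a * (T ^+ m / m`!%:R) <= c m).

Lemma exp_coefs_dominate t M : 0 <= t -> dominates 1 t M (exp_coefs t M).
Proof.
move=> t0; split=> m; rewrite /exp_coefs; last by move=> ->; rewrite mul1r.
by case: ifP => // _; rewrite divr_ge0 ?exprn_ge0.
Qed.

Lemma dominates_le a T M M' c : (M <= M')%N -> dominates a T M' c -> dominates a T M c.
Proof. by move=> MM' [c0 cM]; split=> // m mM; apply: cM (leq_trans mM MM'). Qed.

(** Splitting off [r] contracted letters turns the coefficient of degree
    [p + q] into [(T * t) ^+ r / r!] times a term of the binomial expansion of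
    [(T + t) ^+ (p + q) / (p + q)!]. *)
Lemma star_coef_exp (T t : R) (p q r : nat) :
  (r`! * 'C(p + r, r) * 'C(q + r, r))%:R *
    (T ^+ (p + r) / (p + r)`!%:R * (t ^+ (q + r) / (q + r)`!%:R)) =
  (T * t) ^+ r / r`!%:R * (T ^+ p / p`!%:R * (t ^+ q / q`!%:R)).
Proof.
have h1 := bin_fact (leq_addl p r); rewrite addnK in h1.
have h2 := bin_fact (leq_addl q r); rewrite addnK in h2.
rewrite -h1 -h2 !natrM !exprD exprMn.
have nz n : n`!%:R != 0 :> R by rewrite pnatr_eq0 -lt0n fact_gt0.
have bz n : 'C(n + r, r)%:R != 0 :> R by rewrite pnatr_eq0 -lt0n bin_gt0 leq_addl.
move: (nz p) (nz q) (nz r) (bz p) (bz q).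
move: (p`!%:R) (q`!%:R) (r`!%:R) ('C(p + r, r)%:R) ('C(q + r, r)%:R) => x y z u w.
by move=> *; field; rewrite ?andbT; do ?[apply/andP; split].
Qed.

Lemma exprD_fact (T t : R) d :
  \sum_(p < d.+1) T ^+ p / p`!%:R * (t ^+ (d - p) / (d - p)`!%:R) = (T + t) ^+ d / d`!%:R.
Proof.
rewrite addrC exprDn mulr_suml; apply: eq_bigr => p _.
have pd : (p <= d)%N by rewrite -ltnS.
rewrite -(mulr_natl (t ^+ (d - p) * T ^+ p)) -(bin_fact pd) !natrM.
have nz n : n`!%:R != 0 :> R by rewrite pnatr_eq0 -lt0n fact_gt0.
have bz : 'C(d, p)%:R != 0 :> R by rewrite pnatr_eq0 -lt0n bin_gt0.
move: (nz p) (nz (d - p)%N) bz.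
move: (p`!%:R) ((d - p)`!%:R) ('C(d, p)%:R) => x y z.
by move=> *; field; rewrite ?andbT; do ?[apply/andP; split].
Qed.

(** A product coefficient is a sum of nonnegative terms, from which only those
    with fewer than [r] contracted letters are kept: they draw on degrees below
    [M + r] and add up to the coefficient of the exponential vector of [T + t]
    times the truncation of [expR (T * t)]. *)
Lemma star_coefs_dominate N a T t M r c c' :
  0 <= a -> 0 <= T -> 0 <= t -> (M + r <= N)%N ->
  dominates a T (M + r) c -> dominates 1 t (M + r) c' ->
  dominates (a * exp_sum r (T * t)) (T + t) M (star_coefs N c c').
Proof.
move=> a0 T0 t0 MrN [c0 cM] [c'0 c'M]; split=> [d|d dM].
  by apply: sumr_ge0 => x _; rewrite !mulr_ge0.
have N0 : (0 < N)%N by apply: leq_trans MrN; rewrite ltn_addr // (leq_ltn_trans _ dM).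
(* [p] uncontracted letters in the first factor, [d - p] in the second and [s]
   contracted ones; as all these degrees are below [N], [insubd]
   returns them unchanged. *)
pose h (x : 'I_d.+1 * 'I_r) : 'I_N * 'I_N * 'I_N :=
  (insubd (Ordinal N0) (x.1 + x.2)%N, insubd (Ordinal N0) (d - x.1 + x.2)%N,
   insubd (Ordinal N0) (x.2 : nat)).
have hE x : [/\ (h x).1.1 = (x.1 + x.2)%N :> nat, (h x).1.2 = (d - x.1 + x.2)%N :> nat
    & (h x).2 = x.2 :> nat].
  case: x => p s; have := ltn_ord p; have := ltn_ord s => sr pd.
  rewrite /h /= !val_insubd.
  by rewrite !ifT //; move: sr pd dM MrN; clear; lia.
have h_inj : injective h.
  move=> x y hxy; have [x1 _ x2] := hE x; have [y1 _ y2] := hE y.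
  move: x1 x2; rewrite hxy y1 y2 => xy1 xy2.
  case: x y xy1 xy2 {hxy y1 y2} => [p s] [p' s'] /= xy1 xy2.
  by congr (_, _); apply: val_inj => //=; apply/eqP; rewrite -(eqn_add2r s) -xy1 xy2.
have h_index x : star_index d (h x).
  have [e1 e2 e3] := hE x; rewrite /star_index e1 e2 e3 !leq_addl /=.
  by have := ltn_ord x.1; lia.
pose G (x : 'I_N * 'I_N * 'I_N) := (star_coef x)%:R * (c x.1.1 * c' x.1.2).
have G0 x : 0 <= G x by rewrite !mulr_ge0.
apply: (@le_trans _ _ (\sum_x G (h x))); last first.
  have -> : \sum_x G (h x) = \sum_(y in [set h x | x in [set: 'I_d.+1 * 'I_r]]%SET) G y.
    rewrite big_imset /=; last by move=> x y _ _; apply: h_inj.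
    by apply: eq_bigl => x; rewrite finset.in_setT.
  rewrite big_mkcond [leRHS]big_mkcond /=; apply: ler_sum => x _.
  case: imsetP => [[y _ ->]|_]; first by rewrite h_index.
  by case: ifP => // _; apply: G0.
rewrite -exprD_fact mulr_sumr.
rewrite -(pair_bigA _ (fun p s => G (h (p, s)))) /=; apply: ler_sum => p _.
rewrite /exp_sum mulr_sumr mulr_suml; apply: ler_sum => s _.
have [e1 e2 e3] := hE (p, s); rewrite /= in e1 e2 e3.
rewrite /G /star_coef e1 e2 e3 -mulrA -star_coef_exp mulrCA ler_wpM2l //.
have -> : forall x y : R, a * (x * y) = a * x * (1 * y) by move=> x y; rewrite mul1r mulrA.
apply: ler_pM; rewrite ?mulr_ge0 ?divr_ge0 ?exprn_ge0 //.
  by apply: cM; have := ltn_ord p; have := ltn_ord s; move: dM; clear; lia.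
by apply: c'M; have := ltn_ord p; have := ltn_ord s; move: dM; clear; lia.
Qed.

End ExponentialCoefficients.

Section SingleMode.
Context (R : realType) (H : completeNormedModType R) (dotH : {dot H for idfun}).
Context (E : completeNormedModType R[i]) (dotE : {dot E for Num.conj}).
Context (I J : choiceType) (e : I -> H) (eps : J -> E).
Hypothesis normE : induces_norm dotE.
Hypothesis e_orthonormal : forall a b, dotH (e a) (e b) = (a == b)%:R.
Hypothesis eps_orthonormal : forall a b, dotE (eps a) (eps b) = (a == b)%:R.
Context (i0 : I) (j0 : J).
Implicit Types (K L : chaos H E) (c : nat -> R) (N M d : nat).

Let T : finType := seq_sub [:: i0].
Let uS : uniq [:: j0] := isT.
Let i0F : i0 \in [:: i0] := mem_head i0 [::].

(** [c] lists the coefficients of [K] on the powers of the unit vector [e i0]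
    tensored with the projection on the line of [eps j0]. *)
Definition single_mode N K c : Prop :=
  finite_chaos dotE e eps [:: i0] [:: j0] N K /\
  forall d, K (map e (nseq d i0)) (eps j0) = (c d)%:C%C *: eps j0.

Lemma constant_word (i : seq I) : all (mem [:: i0]) i = (i == nseq (size i) i0).
Proof.
rewrite (@eq_all _ _ (pred1 i0)) => [|x]; last by rewrite /= inE.
by apply/idP/eqP => /all_pred1P.
Qed.

Lemma word_single_mode d (w : d.-tuple T) : map val w = nseq d i0.
Proof.
have /eqP -> : map val w == nseq (size (map val w)) i0.
  by rewrite -constant_word; apply/allP => _ /mapP[x _ ->]; apply: valP.
by rewrite size_map size_tuple.
Qed.

Lemma card_word_single_mode d : #|{: d.-tuple T}| = 1%N.
Proof. by rewrite card_tuple card_seq_sub ?exp1n. Qed.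

Lemma word_norm_single_mode N K c d : single_mode N K c -> 0 <= c d ->
  word_norm d (coef_norm e eps [:: j0] (F := [:: i0]) K) = c d.
Proof.
move=> [fK Kc] cd; rewrite /word_norm /l2norm.
rewrite (eq_bigr (fun=> c d ^+ 2)) => [|w _].
  by rewrite sumr_const card_word_single_mode sqrtr_sqr ger0_norm.
rewrite /coef_norm word_single_mode /hs_norm /l2norm big_seq1 Kc real_normZ.
have -> : real_norm (eps j0) = 1.
  have := real_norm_sqr normE (eps j0); rewrite eps_orthonormal eqxx => h.
  have {}h : real_norm (eps j0) ^+ 2 = 1 by apply: complexI; rewrite h.
  by apply/eqP; rewrite -(@eqrXn2 _ 2) ?real_norm_ge0 // expr1n h.
by rewrite mulr1 ger0_norm ?ler0c //= sqrtr_sqr ger0_norm.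
Qed.

Lemma chaos_norm_single_mode N K c rho : single_mode N K c -> (forall d, 0 <= c d) ->
  chaos_norm dotE e eps rho K =
  (\sum_(d < N) rho ^+ d * Num.sqrt d`!%:R * c d)%:E.
Proof.
move=> sK c0; rewrite (chaos_normE normE eps_orthonormal uS i0F _ sK.1).
congr EFin; apply: eq_bigr => d _.
by rewrite (word_norm_single_mode sK).
Qed.

Lemma single_mode_le N N' K c : (N <= N')%N -> single_mode N K c -> single_mode N' K c.
Proof. by move=> NN' [fK Kc]; split => //; apply: finite_chaos_le NN' fK. Qed.

Lemma permuted_nseq d (s : 'S_d) : permuted i0 s (nseq d i0) = nseq d i0.
Proof.
have := all_permuted [:: i0] i0 s (size_nseq d i0).
rewrite !constant_word size_permuted size_nseq eqxx => /eqP; exact.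
Qed.

Lemma single_mode_star N K L c c' : single_mode N K c -> single_mode N L c' ->
  single_mode (N + N) (star e K L) (star_coefs N c c').
Proof.
move=> [fK Kc] [fL Lc]; split=> [|d]; first exact: (finite_chaos_star i0F fK fL).
rewrite (star_basis i0F fK fL (size_nseq d i0)) /star_sum /star_coefs.
rewrite rmorph_sum scaler_suml; apply: eq_bigr => t /and3P[rm rn /eqP mn].
rewrite (rmorphM (real_complex R)) -scalerA; congr (_ *: _).
have contractedE (s : 'S_d) (j : t.2.-tuple T) :
    contracted e K L (t.1.1 - t.2) (permuted i0 s (nseq d i0)) (map val j) (eps j0) =
    (c t.1.1 * c' t.1.2)%:C%C *: eps j0.
  rewrite permuted_nseq word_single_mode /contracted.
  have word i n : all (mem [:: i0]) i -> size i = n -> i = nseq n i0.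
    by rewrite constant_word => /eqP {2}-> <-.
  have const n : all (mem [:: i0]) (nseq n i0) by rewrite constant_word size_nseq.
  have sub m (i : seq I) : all (mem [:: i0]) i ->
      all (mem [:: i0]) (take m i) && all (mem [:: i0]) (drop m i).
    by move=> iF; rewrite -all_cat cat_take_drop.
  have /andP[all1 all2] := sub (t.1.1 - t.2)%N _ (const d).
  rewrite (word (take _ _ ++ _) t.1.1); last 2 first.
  - by rewrite all_cat all1 const.
  - rewrite size_cat size_nseq size_takel ?subnK // size_nseq -mn -degree_split //.
    by rewrite leq_addr.
  rewrite (word (drop _ _ ++ _) t.1.2); last 2 first.
  - by rewrite all_cat all2 const.
  - by rewrite size_cat !(size_nseq, size_drop) -mn -degree_split // addKn subnK.
  have [lK _ _] := finite_value fK (nseq t.1.1 i0).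
  by rewrite Lc (linear_mapZ _ _ lK) Kc scalerA -rmorphM mulrC.
under eq_bigr => s _ do under eq_bigr do rewrite contractedE.
under eq_bigr do rewrite sumr_const card_word_single_mode mulr1n.
set u : E := _ *: eps j0; rewrite sumr_const card_Sn.
have -> : u *+ d`! = d`!%:R *: u by rewrite scaler_nat.
by rewrite scalerA fmorphV rmorph_nat mulVf ?scale1r.
Qed.

(** The truncated exponential vector of [t *: e i0], tensored with the
    projection on the line of [eps j0]. *)
Definition exp_chaos (M : nat) (t : R) : chaos H E := fun x =>
  symmetrize (elementary dotH (nseq (size x) (e i0))
    (fun v => ((exp_coefs t M (size x))%:C%C * dotE v (eps j0)) *: eps j0)) x.

Lemma exp_chaos_core M t : finite_core dotH dotE e eps (exp_chaos M t).
Proof.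
split=> [|m].
  exists M => x v Mx; rewrite /exp_chaos /symmetrize big1 ?scaler0 // => s _.
  rewrite /elementary /exp_coefs ltnNge Mx /= mul0r scale0r scaler0.
  by case: ifP.
exists 1%N, (fun=> nseq_tuple m i0).
exists (fun=> fun v => ((exp_coefs t M m)%:C%C * dotE v (eps j0)) *: eps j0).
split=> [l|x v xm].
  by exists [:: ((exp_coefs t M m)%:C%C, (j0, j0))] => v; rewrite big_seq1.
by rewrite big_ord1 /exp_chaos /= map_nseq xm.
Qed.

Lemma exp_chaos_single_mode M t : single_mode M (exp_chaos M t) (exp_coefs t M).
Proof.
have valueE (i : seq I) v : exp_chaos M t (map e i) v =
    (if i == nseq (size i) i0 then exp_coefs t M (size i) else 0)%:C%C *:
    (dotE v (eps j0) *: eps j0).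
  rewrite /exp_chaos size_map -map_nseq.
  rewrite (symmetrize_elementary_basis e_orthonormal i0) -!scalerA.
  rewrite (eq_bigr (fun=> (i == nseq (size i) i0)%:R)) => [|s _].
    rewrite sumr_const card_Sn !scalerA; congr (_ *: _).
    case: eqP => _; rewrite ?mul0rn ?mulr0 ?mul0r //.
    by rewrite fmorphV rmorph_nat mulVf ?mul1r.
  have := all_permuted [:: i0] i0 s (erefl (size i)).
  by rewrite !constant_word size_permuted => ->.
split=> [|d]; last first.
  by rewrite valueE size_nseq eqxx eps_orthonormal eqxx scale1r.
split=> [i v Mi|i v|i].
- by rewrite valueE /exp_coefs ltnNge Mi if_same scale0r.
- by rewrite constant_word valueE => /negbTE ->; rewrite scale0r.
apply: (finite_op_of_matrix eps_orthonormal uS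
  (s := [:: ((if i == nseq (size i) i0 then exp_coefs t M (size i) else 0)%:C%C,
             (j0, j0))])) => // v.
by rewrite big_seq1 valueE scalerA.
Qed.

Lemma chaos_norm_exp_chaos M t rho : 0 <= t ->
  chaos_norm dotE e eps rho (exp_chaos M t) = (gauss_sum M (rho * t))%:E.
Proof.
move=> t0; rewrite (chaos_norm_single_mode _ (exp_chaos_single_mode M t)).
  congr EFin; apply: eq_bigr => d _; rewrite /exp_coefs ltn_ord exprMn.
  rewrite -mulrA -[RHS]mulrA; congr (_ * _); rewrite mulrCA; congr (_ * _).
  by rewrite -[X in _ / X]sqr_sqrtr // expr2 invfM mulrA divff ?mul1r // sqrt_fact_neq0.
by have [] := exp_coefs_dominate M t0.
Qed.

(** Multiplying exponential vectors one after the other adds the parameters and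
    collects the scalar factors of [growth]. Each multiplication consumes [n]
    degrees of the range in which the coefficients are controlled, so that the
    factors have to be cut off at a degree [M'] large enough. *)
Lemma dominates_foldl (M' n M : nat) (ts : seq R) N K c a t :
  0 <= a -> 0 <= t -> {in ts, forall u, 0 <= u} ->
  (M + size ts * n <= M')%N ->
  single_mode N K c -> dominates a t (M + size ts * n) c ->
  exists N' c', single_mode N' (foldl (star e) K (map (exp_chaos M') ts)) c' /\
    dominates (a * growth n t ts) (t + \sum_(u <- ts) u) M c'.
Proof.
elim: ts N K c a t => [|u ts IHts] N K c a t a0 t0 ts0 /= MM' sK dom.
  by exists N, c; rewrite big_nil mulr1 addr0; rewrite mul0n addn0 in dom.
have u0 : 0 <= u by rewrite ts0 ?mem_head.
pose N1 := maxn N M'.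
have sK1 := single_mode_le (leq_maxl N M' : (N <= N1)%N) sK.
have su1 := single_mode_le (leq_maxr N M' : (M' <= N1)%N) (exp_chaos_single_mode M' u).
have sKu := single_mode_star sK1 su1.
rewrite mulSn addnCA addnC in MM' dom.
have domu := dominates_le MM' (exp_coefs_dominate M' u0).
have MN1 : (M + size ts * n + n <= N1)%N by rewrite (leq_trans MM') ?leq_maxr.
have domKu := star_coefs_dominate a0 t0 u0 MN1 dom domu.
have [||||N' [c' [s' d']]] := IHts _ _ _ _ _ _ _ _ _ sKu domKu.
- by rewrite mulr_ge0 // exp_sum_ge0 // mulr_ge0.
- by rewrite addr_ge0.
- by move=> x xts; rewrite ts0 // inE xts orbT.
- by rewrite (leq_trans _ MM') // leq_addr.
by exists N', c'; rewrite big_cons addrA mulrA.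
Qed.

Lemma star_seq_exp_chaos (n M : nat) (ts : seq R) sigma :
  (0 < size ts)%N -> {in ts, forall u, 0 <= u} -> 0 <= sigma ->
  ((growth n 0 ts * gauss_sum M (sigma * \sum_(u <- ts) u))%:E <=
   chaos_norm dotE e eps sigma
     (star_seq e (map (exp_chaos (M + size ts * n)) ts)))%E.
Proof.
case: ts => // t ts _ ts0 sigma0; rewrite /star_seq /= big_cons.
have t0 : 0 <= t by rewrite ts0 ?mem_head.
have {}ts0 : {in ts, forall u, 0 <= u}.
  by move=> x xts; rewrite ts0 // inE xts orbT.
set M' := (M + _)%N.
have MM' : (M + size ts * n <= M')%N by rewrite leq_add2l leq_mul2r leqnSn orbT.
have [N [c [sK [c0 cM]]]] := dominates_foldl ler01 t0 ts0 MM'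
  (exp_chaos_single_mode M' t) (dominates_le MM' (exp_coefs_dominate M' t0)).
rewrite (chaos_norm_single_mode _ (single_mode_le (leq_maxl N M) sK) c0) lee_fin.
rewrite mul0r add0r; set g := growth n t ts in cM *; set s := t + _ in cM *.
have g0 : 0 <= g by apply: growth_ge0.
have s0 : 0 <= s by rewrite addr_ge0 // big_seq sumr_ge0.
(* [growth] starts from the parameter [0], which costs the factor
   [exp_sum n 0], equal to [1] unless [n = 0]. *)
have e1 : exp_sum n 0 <= 1 :> R.
  by apply: le_trans (exp_sum_le n (lexx 0)) _; rewrite expR0.
apply: (@le_trans _ _ (g * gauss_sum M (sigma * s))).
  by rewrite ler_wpM2r ?gauss_sum_ge0 ?mulr_ge0 // ler_piMl.
have term0 d : 0 <= sigma ^+ d * Num.sqrt d`!%:R * c d.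
  by rewrite !mulr_ge0 ?exprn_ge0 ?sqrtr_ge0.
apply: (@le_trans _ _ (\sum_(d < M) sigma ^+ d * Num.sqrt d`!%:R * c d)).
  rewrite /gauss_sum mulr_sumr; apply: ler_sum => d _.
  have -> : g * ((sigma * s) ^+ d / Num.sqrt d`!%:R) =
      sigma ^+ d * Num.sqrt d`!%:R * (1 * g * (s ^+ d / d`!%:R)).
    have := sqr_sqrtr (ler0n R d`!); have := sqrt_fact_neq0 R d.
    by move: (Num.sqrt _) => x x0 <-; rewrite exprMn; field.
  by rewrite ler_wpM2l ?cM ?ltn_ord // mulr_ge0 ?exprn_ge0 ?sqrtr_ge0.
rewrite -!(big_mkord xpredT (fun d => sigma ^+ d * Num.sqrt d`!%:R * c d)).
by rewrite [leRHS](big_cat_nat (n := M)) ?leq_maxr //= lerDl sumr_ge0.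
Qed.

End SingleMode.

(** * The sharp radii *)

Section SharpRadii.
Context (R : realType) (H : completeNormedModType R) (dotH : {dot H for idfun}).
Context (E : completeNormedModType R[i]) (dotE : {dot E for Num.conj}).
Context (I J : choiceType) (e : I -> H) (eps : J -> E).
Hypothesis normE : induces_norm dotE.
Hypothesis e_orthonormal : forall a b, dotH (e a) (e b) = (a == b)%:R.
Hypothesis eps_orthonormal : forall a b, dotE (eps a) (eps b) = (a == b)%:R.
Context (i0 : I) (j0 : J) (k : nat) (sigma : R) (rho : 'I_k -> R).
Hypotheses (k_gt0 : (0 < k)%N) (sigma_gt0 : 0 < sigma) (rho_gt0 : forall i, 0 < rho i).

Lemma star_bounded_by_one :
  \sum_(i < k) (1 + rho i ^+ 2)^-1 <= (1 + sigma ^+ 2)^-1 ->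
  star_bounded_by dotH dotE e eps sigma rho 1.
Proof.
move=> radii K core; rewrite mul1e.
have [F [S [uS i0F fK]]] := finite_core_chaoses i0 e_orthonormal eps_orthonormal core.
have prodE : (\prod_(i < k) chaos_norm dotE e eps (rho i) (K i) =
    \prod_(i <- enum 'I_k) chaos_norm dotE e eps (rho i) (K i))%E by rewrite big_enum.
rewrite prodE; move: radii; rewrite -big_enum /=.
case: (enum 'I_k) (size_enum_ord k) => [k0|i s _].
  by have := k_gt0; rewrite -[X in (0 < X)%N]k0.
rewrite !big_cons /= => radii; have [N fKi] := fK i.
exact: (chaos_norm_foldl normE eps_orthonormal uS i0F fKi fK).
Qed.

Lemma star_bounded_growth (C : R) (t : 'I_k -> R) (n : nat) :
  star_bounded_by dotH dotE e eps sigma rho C -> (forall i, 0 <= t i) ->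
  growth n 0 [seq t i | i <- enum 'I_k] * gauss_sum n (sigma * \sum_(i < k) t i) <=
  C * \prod_(i < k) gauss_sum (n + k * n) (rho i * t i).
Proof.
move=> bound t0.
have ts0 : {in [seq t i | i <- enum 'I_k], forall u, 0 <= u}.
  by move=> u /mapP[i _ ->].
have sz : size [seq t i | i <- enum 'I_k] = k by rewrite size_map size_enum_ord.
have := star_seq_exp_chaos normE e_orthonormal eps_orthonormal i0 j0 n n
  (_ : (0 < size [seq t i | i <- enum 'I_k])%N) ts0 (ltW sigma_gt0).
rewrite sz big_map big_enum /= -map_comp => /(_ k_gt0) lower.
rewrite -lee_fin; apply: le_trans lower _.
have := bound (fun i => exp_chaos dotH dotE e eps i0 j0 (n + k * n) (t i))
  (fun i => exp_chaos_core _ _ _ _ _ _ _ _).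
move=> /le_trans; apply.
rewrite (eq_bigr (fun i => (gauss_sum (n + k * n) (rho i * t i))%:E)) => [|i _].
  by rewrite prodEFin.
exact: chaos_norm_exp_chaos.
Qed.

Lemma star_bounded_radii (C : R) :
  star_bounded_by dotH dotE e eps sigma rho C ->
  \sum_(i < k) (1 + rho i ^+ 2)^-1 <= (1 + sigma ^+ 2)^-1.
Proof.
move=> bound; apply: (radii_of_growth (C := C)) => // t n t0.
by exists (n + k * n)%N; apply: star_bounded_growth.
Qed.

Lemma star_bounded_by_ge1 (C : R) :
  star_bounded_by dotH dotE e eps sigma rho C -> 1 <= C.
Proof.
move=> bound; have := star_bounded_growth 1 bound (fun=> lexx (0 : R)).
have gauss0 N : (0 < N)%N -> gauss_sum N 0 = 1 :> R.
  case: N => // N _; rewrite /gauss_sum big_ord_recl /= expr0 sqrtr1 divr1.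
  by rewrite big1 ?addr0 // => j _; rewrite expr0n mul0r.
have growth0 (ts : seq R) T : growth 1 T ts = 1.
  elim: ts T => //= u ts IHts T; rewrite IHts mulr1 /exp_sum big_ord1.
  by rewrite expr0 divr1.
rewrite growth0 mul1r big1 // mulr0 gauss0 // => le1; apply: le_trans le1 _.
by rewrite big1 ?mulr1 // => i _; rewrite mulr0 gauss0.
Qed.

End SharpRadii.

Theorem theorem4p3 (R : realType)
  (H : completeNormedModType R) (dotH : {dot H for idfun})
  (E : completeNormedModType R[i]) (dotE : {dot E for Num.conj})
  (I J : choiceType) (e : I -> H) (eps : J -> E)
  (k : nat) (sigma : R) (rho : 'I_k -> R)
  (normH : induces_norm dotH) (normE : induces_norm dotE)
  (sepH : separable_space H) (sepE : separable_space E)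
  (nzH : exists x : H, x != 0) (nzE : exists v : E, v != 0)
  (onbH : orthonormal_basis dotH e) (onbE : orthonormal_basis dotE eps)
  (hk : (2 <= k)%N) (hsigma : 1 <= sigma) (hrho : forall i, 0 < rho i) :
  [/\ star_bounded dotH dotE e eps sigma rho <->
        \sum_(i < k) (1 + rho i ^+ 2)^-1 <= (1 + sigma ^+ 2)^-1,
      \sum_(i < k) (1 + rho i ^+ 2)^-1 <= (1 + sigma ^+ 2)^-1 ->
        star_bounded_by dotH dotE e eps sigma rho 1 /\
        (forall C : R, star_bounded_by dotH dotE e eps sigma rho C -> 1 <= C)
    & forall r : R, (forall i, rho i = r) ->
        (star_bounded dotH dotE e eps sigma rho <->
         k%:R * (1 + sigma ^+ 2) - 1 <= r ^+ 2)].
Proof.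
have [e_orth e_max] := onbH; have [eps_orth eps_max] := onbE.
have [i0 _] : exists i : I, True.
  apply: contrapT => noI; have [x /eqP] := nzH; apply; apply: e_max => i.
  by case: noI; exists i.
have [j0 _] : exists j : J, True.
  apply: contrapT => noJ; have [v /eqP] := nzE; apply; apply: eps_max => j.
  by case: noJ; exists j.
have k0 : (0 < k)%N by apply: leq_trans hk.
have sigma0 : 0 < sigma by apply: lt_le_trans hsigma.
have iff : star_bounded dotH dotE e eps sigma rho <->
    \sum_(i < k) (1 + rho i ^+ 2)^-1 <= (1 + sigma ^+ 2)^-1.
  split=> [[C]|radii]; first exact: star_bounded_radii.
  by exists 1; apply: star_bounded_by_one.
split=> // [radii|r rhoE].
  split; first exact: star_bounded_by_one.
  by move=> C; apply: star_bounded_by_ge1.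
apply: iff_trans iff _.
rewrite (eq_bigr (fun=> (1 + r ^+ 2)^-1)) => [|i _]; last by rewrite rhoE.
rewrite sumr_const card_ord -[leLHS]mulr_natl.
have r0 : 0 < 1 + r ^+ 2 by rewrite ltr_pwDl ?sqr_ge0.
have s0 : 0 < 1 + sigma ^+ 2 by rewrite ltr_pwDl ?sqr_ge0.
by rewrite ler_pdivrMr // mulrC ler_pdivlMr // lerBlDl.
Qed.
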